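(* Let $\delta \in \{\mathsf N,\mathsf D,\mathsf U,\mathsf X\}^n$. The transitive closure of the increasing rotation graph on the set $\mathcal{PT}(\delta)$ of $\delta$-permutrees is a lattice (called the $\delta$-permutree lattice). The map $\mathbf P:\mathfrak S^\delta\to\mathcal{PT}(\delta)$ defines a lattice homomorphism from the weak order on $\mathfrak S^\delta$ to the $\delta$-permutree lattice on $\mathcal{PT}(\delta)$.
   Context: Permutrees. A decoration of size $n$ is a word $\delta=\delta_1\cdots\delta_n$ in the symbols $\mathsf N$ (none), $\mathsf D$ (down), $\mathsf U$ (up), $\mathsf X$ (both). A permutree is a directed tree $T$ with $n$ vertices labeled bijectively by $[n]=\{1,\dots,n\}$ (vertices are identified with labels) in which each vertex has one or two parents (outgoing neighbors) and one or two children (incoming neighbors); a parent or child may be an unlabeled leaf (dangling edge), so ancestor and descendant subtrees may be empty. The ancestor (resp. descendant) subtree of $i$ through a given parent (resp. child) is the whole connected component, reached through it, of the tree with $i$ removed. If $i$ has two parents (resp. children), they are distinguished as left and right, and all labels in the left ancestor (resp. descendant) subtree of $i$ are smaller than $i$ while all labels in the right one are larger than $i$. The decoration of $T$ is given by $\delta(T)_i=\mathsf N,\mathsf D,\mathsf U,\mathsf X$ according to whether $i$ has (one parent, one child), (one parent, two children), (two parents, one child), (two parents, two children). A $\delta$-permutree is a permutree with decoration $\delta$ (up to label-preserving isomorphism). Insertion map $\mathbf P$. $\mathfrak S^\delta$ is the set of permutations $\tau$ of $[n]$ with each value $j$ decorated by $\delta_j$. Given $\tau\in\mathfrak S^\delta$,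 draw for each $j\in[n]$ a vertex $v_j$ at the point $(j,\tau^{-1}(j))$; draw a vertical wall going down from $v_j$ if $\delta_j\in\{\mathsf D,\mathsf X\}$ and a vertical wall going up from $v_j$ if $\delta_j\in\{\mathsf U,\mathsf X\}$. Sweep from bottom to top with a horizontal line, starting with exactly one strand in each of the intervals determined by the walls of the values decorated $\mathsf D$ or $\mathsf X$. When $v_j$ is swept: if $\delta_j\in\{\mathsf N,\mathsf U\}$, $v_j$ catches the unique strand in the interval of the sweeping line (between walls) containing it, and if $\delta_j\in\{\mathsf D,\mathsf X\}$, it catches the two strands in the intervals just to its left and just to its right; then, if $\delta_j\in\{\mathsf N,\mathsf D\}$, $v_j$ creates one outgoing strand, and if $\delta_j\in\{\mathsf U,\mathsf X\}$, it creates two outgoing strands, just to the left and just to the right of its upper wall. Strands are oriented upwards. The resulting tree, with $v_j$ labeled $j$, is the $\delta$-permutree $\mathbf P(\tau)$. Rotations. Let $i\to j$ be an edge of a $\delta$-permutree $T$ with $i<j$. Let $B$ be the only (resp. the right) descendant subtree of $i$ if $\delta_i\in\{\mathsf N,\mathsf U\}$ (resp. if $\delta_i\in\{\mathsf D,\mathsf X\}$), and $A$ the only (resp. the left) ancestor subtree of $j$ if $\delta_j\in\{\mathsf N,\mathsf D\}$ (resp. if $\delta_j\in\{\mathsf U,\mathsf X\}$). The (increasing) rotation of $i\to j$ transforms $T$ into the tree $T'$ obtained by reversing the edge $i\to j$ into $j\to i$, attaching $A$ as ancestor subtree to $i$ (in the place of $j$) and $B$ as descendant subtree to $j$ (in the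 place of $i$). The increasing rotation graph on $\mathcal{PT}(\delta)$ has an arc $T\to T'$ for each such rotation; its (reflexive) transitive closure has $T$ below $T'$ for each such arc. Weak order. The weak order on $\mathfrak S^\delta\cong\mathfrak S_n$ is the inclusion order of the sets of inversions, an inversion of $\tau$ being a pair of values $i<j$ with $\tau^{-1}(i)>\tau^{-1}(j)$. *)

(* Defs.v *)
From HB Require Import structures.
From mathcomp Require Import all_boot all_fingroup.

Set Implicit Arguments.
Unset Strict Implicit.
Unset Printing Implicit Defensive.

(* The labels 1, ..., n are represented by the ordinals 0, ..., n - 1.         *)

Section Lattices.

Variable T : Type.
Implicit Types (le : rel T) (x y z : T).

Definition is_join le x y z : Prop :=
  [/\ le x z, le y z & forall u, le x u -> le y u -> le z u].

Definition is_meet le x y z : Prop :=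
  [/\ le z x, le z y & forall u, le u x -> le u y -> le u z].

Definition is_lattice le : Prop :=
  [/\ reflexive le, antisymmetric le, transitive le,
      forall x y, exists z, is_join le x y z
    & forall x y, exists z, is_meet le x y z].

End Lattices.

(* Both orders are required to be lattices, so that the preservation clauses  *)
(* are never vacuous.                                                         *)
Definition lattice_homomorphism (S T : Type) (leS : rel S) (leT : rel T)
    (f : S -> T) : Prop :=
  [/\ is_lattice leS, is_lattice leT,
      forall x y z, is_join leS x y z -> is_join leT (f x) (f y) (f z)
    & forall x y z, is_meet leS x y z -> is_meet leT (f x) (f y) (f z)].

Inductive decoration : Type := DecN | DecD | DecU | DecX.

Definition has_down (d : decoration) : bool :=
  match d with DecD | DecX => true | DecN | DecU => false end.

Definition has_up (d : decoration) : bool :=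
  match d with DecU | DecX => true | DecN | DecD => false end.

Section Permutrees.

Variable n : nat.
Implicit Types (E : {set 'I_n * 'I_n}) (i j k p : 'I_n).

(* A directed tree is given by the set E of its arcs between labeled          *)
(* vertices, (i, j) standing for the arc i -> j (j is a parent of i).         *)
(* Unlabeled leaves are not recorded: for a given decoration, they fill the   *)
(* parent and child positions left free by E. Hence equality of arc sets is   *)
(* label-preserving isomorphism of trees with the same decoration.            *)
Definition adjacent E : rel 'I_n :=
  fun i j => ((i, j) \in E) || ((j, i) \in E).

(* The bound on the length of the cycles is harmless as they are              *)
(* duplicate-free; the first condition excludes loops and opposite arcs.      *)
Definition directed_tree E : bool :=
  [&& [forall i : 'I_n, forall j : 'I_n, ((i, j) \in E) ==> ((j, i) \notin E)],
      [forall i : 'I_n, forall j : 'I_n, connect (adjacent E) i j]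
    & [forall k : 'I_n.+1, forall c : k.-tuple 'I_n,
         (2 < k) ==> ~~ ucycleb (adjacent E) c]].

Definition parents E i : {set 'I_n} := [set p | (i, p) \in E].
Definition children E i : {set 'I_n} := [set c | (c, i) \in E].

(* The connected component of p in the tree with the vertex i removed, i.e.,  *)
(* the ancestor (resp. descendant) subtree of i through the parent (resp.     *)
(* child) p.                                                                  *)
Definition subtree E i p : {set 'I_n} :=
  [set k | connect [rel x y | [&& adjacent E x y, x != i & y != i]] p k].

(* The condition on the labeled parents (or children) nbrs of i, when it has  *)
(* two (if two is true) or one parent (or child), leaves included. A left     *)
(* (resp. right) neighbor p belongs to its own subtree, so it is smaller      *)
(* (resp. larger) than i: sides are read off from the labels.                 *)
Definition valid_neighbors E i (two : bool) (nbrs : {set 'I_n}) : bool :=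
  if two then
    [&& #|[set p in nbrs | p < i]| <= 1,
        #|[set p in nbrs | i < p]| <= 1,
        [forall p in nbrs, (p < i) ==> [forall k in subtree E i p, k < i]]
      & [forall p in nbrs, (i < p) ==> [forall k in subtree E i p, i < k]]]
  else #|nbrs| <= 1.

Variable delta : 'I_n -> decoration.

Definition is_permutree E : bool :=
  [&& directed_tree E,
      [forall i, valid_neighbors E i (has_up (delta i)) (parents E i)]
    & [forall i, valid_neighbors E i (has_down (delta i)) (children E i)]].

Record permutree : Type :=
  Permutree { arcs : {set 'I_n * 'I_n}; _ : is_permutree arcs }.

HB.instance Definition _ := [isSub for arcs].
HB.instance Definition _ := [Finite of permutree by <:].

(* For the rotation of i -> j, let A be the only (or left) ancestor subtree   *)
(* of j and B the only (or right) descendant subtree of i. The sets rotA and  *)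
(* rotB consist of the vertex through which A (resp. B) is attached to j      *)
(* (resp. i), and are empty when that subtree is a leaf.                      *)
Definition rotA E j : {set 'I_n} :=
  [set a in parents E j | has_up (delta j) ==> (a < j)].

Definition rotB E i : {set 'I_n} :=
  [set b in children E i | has_down (delta i) ==> (i < b)].

Definition rotate E i j : {set 'I_n * 'I_n} :=
  (E :\: ([set (i, j)] :|: [set (j, a) | a in rotA E j]
                       :|: [set (b, i) | b in rotB E i]))
  :|: ([set (j, i)] :|: [set (i, a) | a in rotA E j]
                    :|: [set (b, j) | b in rotB E i]).

Definition increasing_rotation : rel permutree :=
  fun T T' => [exists i : 'I_n, exists j : 'I_n,
    [&& i < j, (i, j) \in arcs T & arcs T' == rotate (arcs T) i j]].

Definition permutree_le : rel permutree := connect increasing_rotation.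

Section Insertion.

Variable tau : 'S_n.

Definition pos j : 'I_n := (tau^-1)%g j.

(* wall t k: when the vertices in positions < t have been swept, the sweeping *)
(* line meets a wall at abscissa k (the lower wall of v_k if v_k is not swept *)
(* yet, its upper wall otherwise).                                            *)
Definition wall (t : nat) k : bool :=
  if t <= pos k then has_down (delta k) else has_up (delta k).

(* For 0 <= g <= n, the gap g is the set of abscissas strictly between the    *)
(* ordinals g - 1 and g, so that the gaps just to the left and to the right   *)
(* of v_j are j and j.+1.                                                     *)
Definition same_interval (t g h : nat) : bool :=
  [forall k : 'I_n, wall t k ==> ~~ (minn g h <= k < maxn g h)].

(* origin t g is the vertex which created the strand in the interval          *)
(* containing the gap g once the vertices in positions < t have been swept;   *)
(* it is None for an initial strand. The vertex v_j in position t creates the *)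
(* strands of the intervals just to its left and to its right on the new      *)
(* line, which are one and the same interval if v_j has no upper wall.        *)
Fixpoint origin (t g : nat) : option 'I_n :=
  if t is t'.+1 then
    if [pick j | (pos j == t' :> nat) &&
                 (same_interval t g j || same_interval t g j.+1)] is Some j
    then Some j else origin t' g
  else None.

(* The arcs i -> j, where i created a strand caught by v_j, i.e., the strand  *)
(* just to the left or just to the right of v_j when v_j is reached (these    *)
(* are one and the same strand if v_j has no lower wall).                     *)
Definition insertion : {set 'I_n * 'I_n} :=
  [set a : 'I_n * 'I_n | (origin (pos a.2) a.2 == Some a.1)
                      || (origin (pos a.2) a.2.+1 == Some a.1)].

End Insertion.

End Permutrees.

Definition inversions (n : nat) (tau : 'S_n) : {set 'I_n * 'I_n} :=
  [set a : 'I_n * 'I_n | (a.1 < a.2) && (pos tau a.2 < pos tau a.1)].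

Definition weak_le (n : nat) : rel 'S_n :=
  fun sigma tau => inversions sigma \subset inversions tau.

(* Main.v *)
Require Import Defs.
From mathcomp Require Import all_boot all_fingroup zify.

Set Implicit Arguments.
Unset Strict Implicit.
Unset Printing Implicit Defensive.

(* For a value x swept before y, x is a descendant of y in the insertion of   *)
(* tau iff no two walls block the way: along the labels from x to y, every    *)
(* lower wall (or x) comes before every upper wall (or y) met after it. This  *)
(* relation [prec] is a partial order whose covers are the arcs of the        *)
(* insertion, and any linear extension of a permutree inserts to it. Pairs    *)
(* related decreasingly (increasingly) by [prec] are closed and coclosed, so  *)
(* they form the inversions (noninversions) of a minimum (maximum) linear     *)
(* extension. Exchanging two consecutive values i < j of tau either preserves *)
(* the insertion or rotates the arc i -> j. Hence the minimum and the maximum *)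
(* linear extensions are the two adjoints of the surjective monotone map P,   *)
(* which therefore carries the lattice structure over and preserves it.       *)

(** * The tree order of an insertion *)

(** Heights [p] stand for positions in a permutation, [dn] and [up] for the lower and upper walls.
    The strand that y catches on one side was created by the last vertex that sees y from there, and
    these last vertices are exactly the elements covered by y in [prec] ([cov_visP],
    [insertion_cover]). Covers never cross a wall, so a simple path that leaves y through a child
    stays on the side of that child when y has a lower wall ([cov_side]). This rules out cycles and
    gives the conditions on subtrees, so the covers form a permutree.

    Conversely, a simple path of a permutree can turn only at a vertex with a wall, and that vertex
    separates the start of the path from all that follows the turn. For any linear extension of the
    tree, arcs are therefore visible pairs and visible pairs are joined by increasing paths, so the
    tree is the graph of covers of the extension ([permutree_cover_arcs]). Thus the fibre of P over
    T is the set of linear extensions of T.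

    A rotation of i -> j is the exchange of i and j in a linear extension where they are consecutive
    ([adjacent_linear_extension], [rotate_cover]), and conversely every cover of the weak order maps
    to a rotation or to an equality ([weak_permutree_le]). Along both orders the decreasing
    relations of the tree grow and the increasing ones shrink ([weak_below], [permutree_le_below]).
    By [prec_between], the decreasing pairs of T and the complement of its increasing pairs are
    inversion sets; they yield the least and the greatest linear extensions ([min_permutation],
    [max_permutation]), which are adjoint to P on either side. Adjunction preserves joins and meets
    and transports the lattice structure ([adjoint_lattice_homomorphism]). *)

Definition btw (x b y : nat) : bool := (x < b < y) || (y < b < x).

Lemma ord_ltgt n (x y : 'I_n) : [\/ x < y, y < x | x = y].
Proof.
by case: (ltngtP x y) => [h|h|/val_inj h]; [apply: Or31|apply: Or32|apply: Or33].
Qed.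

Section Precedence.

Variables (n : nat) (p : 'I_n -> nat) (dn up : pred 'I_n).
Implicit Types x y z b c : 'I_n.

(* No wall separates x from y just after x is swept.                         *)
Definition vis x y : Prop :=
  p x < p y /\
  forall b, btw x b y -> (dn b -> p b < p x) /\ (up b -> p x < p b).

(* No wall separates x from y at any time between the two.                   *)
Definition unwalled x y : Prop :=
  p x < p y /\
  forall b, btw x b y -> (dn b -> p b < p x) /\ (up b -> p y < p b).

(** Equivalently, some curve rises from x to y, monotone in abscissa, passing over each vertex with
    a lower wall and under each vertex with an upper wall. The last clause is the compatibility of
    these constraints along the curve. *)
Definition prec x y : bool :=
  [&& p x < p y,
      [forall b : 'I_n, btw x b y ==> (dn b ==> (p b < p y)) && (up b ==> (p x < p b))]
    & [forall b : 'I_n, forall c : 'I_n,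
        [&& btw x b c, btw b c y, dn b & up c] ==> (p b < p c)]].

Definition cov x y : bool := prec x y && [forall z, ~~ (prec x z && prec z y)].

Lemma precP x y :
  reflect [/\ p x < p y,
              forall b, btw x b y -> (dn b -> p b < p y) /\ (up b -> p x < p b)
            & forall b c, btw x b c -> btw b c y -> dn b -> up c -> p b < p c]
          (prec x y).
Proof.
apply: (iffP and3P) => -[h1 h2 h3]; split=> //.
- move=> b hb; move/forallP/(_ b): h2; rewrite hb /= => /andP[h h'].
  by split; apply/implyP.
- move=> b c hb hc db uc; move/forallP/(_ b)/forallP/(_ c): h3.
  by rewrite hb hc db uc.
- apply/forallP=> b; apply/implyP=> /h2[h h'].
  by apply/andP; split; apply/implyP.
- by apply/forallP=> b; apply/forallP=> c; apply/implyP=> /and4P[]; apply: h3.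
Qed.

Lemma covP x y :
  reflect (prec x y /\ forall z, prec x z -> prec z y -> False) (cov x y).
Proof.
apply: (iffP andP) => -[h1 h2]; split=> //.
- by move=> z xz zy; move/forallP/(_ z): h2; rewrite xz zy.
- by apply/forallP=> z; apply/negP=> /andP[/h2].
Qed.

Lemma prec_lt x y : prec x y -> p x < p y.
Proof. by case/precP. Qed.

Lemma cov_lt x y : cov x y -> p x < p y.
Proof. by case/covP=> /prec_lt. Qed.

Lemma vis_prec x y : vis x y -> prec x y.
Proof.
case=> h1 h2; apply/precP; split=> //.
- by move=> b /h2[h h']; split=> // /h; lia.
- move=> b c bb cc db uc.
  have /h2[/(_ db) + _] : btw x b y by rewrite /btw in bb cc *; lia.
  have /h2[_ /(_ uc)] : btw x c y by rewrite /btw in bb cc *; lia.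
  lia.
Qed.

Lemma prec_trans : transitive prec.
Proof.
move=> y x z /precP[a1 a2 a3] /precP[b1 b2 b3]; apply/precP; split; first lia.
- move=> b hb; have := a2 b; have := b2 b.
  case: (ord_ltgt b y) => [|| e]; rewrite /btw in hb *; try lia.
  by subst; split; lia.
- move=> b c hb hc db uc.
  have := a2 b; have := b2 b; have := a2 c; have := b2 c.
  have := a3 b c; have := b3 b c; rewrite db uc.
  case: (ord_ltgt b y) => [|| e]; case: (ord_ltgt c y) => [|| e'];
    try (subst b); try (subst c); rewrite /btw in hb hc *; lia.
Qed.

(** If x does not see y, what hides y is a lower wall still standing, since [prec] excludes the
    upper walls. The owner of the hiding lower wall nearest to x is an intermediate element. *)
Lemma prec_vis_split x y : injective p -> prec x y ->
  vis x y \/ exists2 b, prec x b & prec b y.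
Proof.
move=> pI /precP[h1 h2 h3].
have [/existsP[b0 hb0]|/existsPn nb] :=
  boolP [exists b : 'I_n, [&& btw x b y, dn b & p x < p b]]; last first.
  left; split=> // b hb; have [h4 h5] := h2 b hb; split=> // db.
  have := nb b; rewrite hb db /= -leqNgt leq_eqVlt => /orP[/eqP/pI e|//].
  by subst; rewrite /btw in hb; lia.
right; pose d (b : 'I_n) := (b - x) + (x - b).
have [b /and3P[hb db pb] bmin] := @arg_minnP _ b0
  (fun b : 'I_n => [&& btw x b y, dn b & p x < p b]) d hb0.
have [h4 h5] := h2 b hb.
exists b; apply/precP; split; [by []| | |by auto| |].
- move=> c hc; have hc' : btw x c y by rewrite /btw in hb hc *; lia.
  have [h6 h7] := h2 c hc'; split=> // dc.
  have := bmin c; rewrite hc' dc /= /d.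
  case: (ltnP (p x) (p c)) => [_ /(_ isT)|]; last by lia.
  by rewrite /btw in hb hc; lia.
- move=> c e hc he; apply: h3 => //; rewrite /btw in hb hc he *; lia.
- move=> c hc; have hc' : btw x c y by rewrite /btw in hb hc *; lia.
  have [h6 h7] := h2 c hc'; split=> // uc.
  by apply: h3 => //; rewrite /btw in hb hc *; lia.
- move=> c e hc he; apply: h3 => //; rewrite /btw in hb hc he *; lia.
Qed.

Lemma prec_vis_last x y : injective p -> prec x y ->
  exists2 z, (z == x) || prec x z & vis z y.
Proof.
move=> pI; have [m] := ubnP (p y - p x); elim: m x => // m IH x hm xy.
case: (prec_vis_split pI xy) => [v|[b xb bY]].
  by exists x; rewrite ?eqxx.
have := prec_lt xb; have := prec_lt bY => h1 h2.
have [|z /predU1P[->|bz] vz] := IH b _ bY; first lia.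
- by exists b; rewrite ?xb ?orbT.
- by exists z; rewrite // (prec_trans xb bz) orbT.
Qed.

Lemma prec_connect x y : prec x y -> connect cov x y.
Proof.
have [m] := ubnP (p y - p x); elim: m x y => // m IH x y hm xy.
have [/existsP[z /andP[xz zy]]|/existsPn nz] :=
  boolP [exists z, prec x z && prec z y].
  have := prec_lt xz; have := prec_lt zy => h1 h2.
  by apply: connect_trans (IH x z _ xz) (IH z y _ zy); lia.
by apply/connect1/andP; split=> //; apply/forallP.
Qed.

(** A label between x and z lies between x and y or between z and y, where visibility controls it,
    or it is y itself. Only the lower wall of y can then obstruct, as z is swept before y. *)
Lemma vis_later x y z : vis x y -> vis z y -> p x < p z ->
  ~~ (dn y && btw x y z) -> prec x z.
Proof.
move=> [v1 v2] [w1 w2] h ns; apply/precP; split=> //.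
- move=> b hb; have := v2 b; have := w2 b.
  case: (ord_ltgt b y) => [|| e]; rewrite /btw in hb ns *; try lia.
  by subst; split; lia.
- move=> b c hb hc db uc.
  have := v2 b; have := w2 b; have := v2 c; have := w2 c.
  case: (ord_ltgt b y) => [|| e]; case: (ord_ltgt c y) => [|| e'];
    try (subst b); try (subst c); rewrite /btw in hb hc ns *; lia.
Qed.

(** The bridge from the order to the sweep: x is covered by y when it is the last vertex that sees y
    on its side of the lower wall of y. *)
Lemma cov_visP x y : injective p ->
  cov x y <-> vis x y /\ forall z, p x < p z -> vis z y -> dn y && btw x y z.
Proof.
move=> pI; split=> [/covP[xy nz]|[v nz]].
  have v : vis x y by case: (prec_vis_split pI xy) => // -[b /nz].
  split=> // z h vz; apply/negPn/negP => /(vis_later v vz h) /nz; apply.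
  exact: vis_prec.
apply/covP; split=> [|z xz zy]; first exact: vis_prec.
(* Replacing z by a vertex w that sees y, the lower wall of y separates x from w. It still stands
   when w is swept, against [prec x w]. *)
have [w hw vw] := prec_vis_last pI zy.
have xw : prec x w by case/predU1P: hw => [->|]//; apply: prec_trans.
have /andP[dy hy] := nz w (prec_lt xw) vw.
have [_ /(_ y hy)[/(_ dy)]] := precP _ _ xw.
by case: vw; lia.
Qed.

End Precedence.

Section Duality.

Variables (n : nat) (p : 'I_n -> nat).
Implicit Types (dn up : pred 'I_n) (x y z b : 'I_n).

(* Turning the picture upside down exchanges the two kinds of walls.          *)
Definition opp_height x : nat := (\max_z p z) - p x.

Lemma opp_height_lt x y : (opp_height x < opp_height y) = (p y < p x).
Proof.
have := leq_bigmax (F := p) x; have := leq_bigmax (F := p) y.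
by rewrite /opp_height; lia.
Qed.

Lemma opp_height_inj : injective p -> injective opp_height.
Proof.
move=> pI x y exy; apply: pI.
have := opp_height_lt x y; have := opp_height_lt y x; rewrite exy.
by lia.
Qed.

Lemma btwC (x b y : nat) : btw x b y = btw y b x.
Proof. by rewrite /btw orbC. Qed.

Lemma prec_opp dn up x y : prec opp_height up dn x y = prec p dn up y x.
Proof.
apply/precP/precP => -[h1 h2 h3]; split=> [|b|b c hb hc db uc].
- by rewrite -opp_height_lt.
- by rewrite btwC => /h2[]; rewrite !opp_height_lt.
- by rewrite -opp_height_lt h3 // btwC.
- by rewrite opp_height_lt.
- by rewrite btwC !opp_height_lt => /h2[].
- by rewrite opp_height_lt h3 // btwC.
Qed.

Lemma cov_opp dn up x y : cov opp_height up dn x y = cov p dn up y x.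
Proof.
rewrite /cov prec_opp; congr (_ && _); apply: eq_forallb => z.
by rewrite !prec_opp andbC.
Qed.

End Duality.

Section Covers.

Variables (n : nat) (p : 'I_n -> nat) (dn up : pred 'I_n).
Hypothesis pI : injective p.
Implicit Types x y z b : 'I_n.

Local Notation prec := (prec p dn up).
Local Notation cov := (cov p dn up).

(** Visibility speaks of the moment when x is swept; applied upside down, it speaks of the moment
    when y is. Together they clear the whole time in between. *)
Lemma cov_unwalled x y : cov x y -> unwalled p dn up x y.
Proof.
move=> /[dup] /(cov_visP _ _ _ _ pI)[[h1 h2] _].
rewrite -cov_opp => /(cov_visP _ _ _ _ (opp_height_inj pI))[[h3 h4] _].
split=> // b hb; have [h5 _] := h2 b hb; split=> //.
by move: hb; rewrite btwC => /h4[]; rewrite !opp_height_lt.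
Qed.

(** Two parents on the same side of the upper wall would be comparable, the lower one preceding the
    higher one, which then could not cover x. *)
Lemma cov_parent_uniq x y z : cov x y -> cov x z -> up x && btw y x z = false ->
  y = z.
Proof.
wlog lt_yz : y z / p y < p z => [IH cy cz h|].
  case: (ltngtP (p y) (p z)) => [lt|lt|/pI//]; first exact: IH lt cy cz h.
  by symmetry; apply: IH lt cz cy _; rewrite btwC.
move=> cy /[dup] cz /covP[xz nz] h.
have [y1 y2] := cov_unwalled cy; have [z1 z2] := cov_unwalled cz.
suff /nz[] : prec y z by case/covP: cy.
apply/precP; split=> // [b hb|b c hb hc db uc].
  have := y2 b; have := z2 b.
  case: (ord_ltgt b x) => [|| e]; rewrite /btw in hb h *; try lia.
  by subst; split; lia.
have := y2 b; have := z2 b; have := y2 c; have := z2 c.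
by case: (ord_ltgt b x) => [|| e]; case: (ord_ltgt c x) => [|| e'];
  try (subst b); try (subst c); rewrite /btw in hb hc h *; lia.
Qed.

Lemma cov_noncrossing x y b : cov x y -> dn b -> p x < p b -> p y < p b ->
  (x < b) = (y < b).
Proof.
move=> /cov_unwalled[_ h] db xb yb; have := h b; rewrite db /btw.
case: (ord_ltgt x b) => [||e]; case: (ord_ltgt y b) => [||e'];
  try (subst x); try (subst y); lia.
Qed.

(** No wall fits between consecutive labels. Their comparability makes the graph of covers
    connected. *)
Lemma prec_succ x y : p x < p y -> (x.+1 == y) || (y.+1 == x) -> prec x y.
Proof.
by move=> h e; apply/precP; split=> // [b|b c]; rewrite /btw; lia.
Qed.

End Covers.

Lemma cov_child_uniq n (p : 'I_n -> nat) dn up (x y z : 'I_n) : injective p ->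
  cov p dn up x z -> cov p dn up y z -> dn z && btw x z y = false -> x = y.
Proof.
move=> pI; rewrite -(cov_opp p dn up z x) -(cov_opp p dn up z y).
by move=> cx cy; apply: (cov_parent_uniq (opp_height_inj pI) cx cy).
Qed.

(** * Paths in the graph of covers *)

Lemma path_turn (T : Type) (e : rel T) x s :
    path (fun a b => e a b || e b a) x s ->
  [\/ path e x s, path (fun a b => e b a) x s
    | exists s1 v w s2, s = s1 ++ v :: w :: s2 /\
        (path e x (rcons s1 v) && e w v
         || path (fun a b => e b a) x (rcons s1 v) && e v w)].
Proof.
elim/last_ind: s => [|s z IH]; first by move=> _; apply: Or31.
rewrite rcons_path => /andP[/IH[] {}IH hz].
- case/orP: hz => hz; first by apply: Or31; rewrite rcons_path IH.
  case/lastP: s IH hz => [|s v] IH hz; first by apply: Or32; rewrite /= hz.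
  rewrite last_rcons in hz.
  by apply: Or33; exists s, v, z, [::]; rewrite -cats1 cat_rcons IH hz.
- case/orP: hz => hz; last by apply: Or32; rewrite rcons_path IH.
  case/lastP: s IH hz => [|s v] IH hz; first by apply: Or31; rewrite /= hz.
  rewrite last_rcons in hz.
  by apply: Or33; exists s, v, z, [::]; rewrite -cats1 cat_rcons IH hz orbT.
- case: IH => s1 [v [w [s2 [-> h]]]].
  by apply: Or33; exists s1, v, w, (rcons s2 z); rewrite rcons_cat.
Qed.

Section Paths.

Variables (n : nat) (p : 'I_n -> nat) (dn up : pred 'I_n).
Hypothesis pI : injective p.
Local Notation cov := (cov p dn up).
Local Notation adj := (fun x y => cov x y || cov y x).

Lemma path_below_side x s b : path adj x s -> dn b ->
  (forall z, z \in x :: s -> p z < p b) -> (last x s < b) = (x < b).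
Proof.
move=> + db; elim: s x => //= z s IH x /andP[xz /IH zs] h.
rewrite zs; last by move=> t ht; apply: h; rewrite in_cons ht orbT.
have hx : p x < p b by apply: h; rewrite in_cons eqxx.
have hz : p z < p b by apply: h; rewrite !in_cons eqxx orbT.
by case/orP: xz => /(cov_noncrossing pI) => [h'|->//]; rewrite (h' b).
Qed.

Lemma path_down_bounds x s : path (fun a b => cov b a) x s ->
  forall z, z \in x :: s -> p (last x s) <= p z <= p x.
Proof.
elim: s x => [|y s IH] x /=; first by move=> _ z; rewrite inE => /eqP->; lia.
case/andP=> /cov_lt yx /IH {}IH z; rewrite in_cons => /predU1P[->|/IH].
  by have := IH y; rewrite in_cons eqxx => /(_ isT); lia.
by lia.
Qed.

End Paths.

(* At the first turn, the path leaves the wall of the turning vertex v on the *)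
(* side opposite to y, and by induction never comes back.                     *)
Lemma cov_side n (p : 'I_n -> nat) dn up y c s : injective p ->
    path (fun x y => cov p dn up x y || cov p dn up y x) y (c :: s) ->
    uniq (y :: c :: s) -> dn y -> cov p dn up c y ->
  (last c s < y) = (c < y).
Proof.
have [m] := ubnP (size s); elim: m p dn up y c s => // m IH p dn up y c s.
move=> hm pI ys us dy cy; have pcy := cov_lt cy.
have dir s1 v w s2 : c :: s = s1 ++ v :: w :: s2 ->
    path (cov p dn up) y (rcons s1 v) -> False.
  by case: s1 => [|v1 s1] [<- _] /= /andP[/cov_lt]; lia.
case: (path_turn ys) => [/=/andP[/cov_lt]|/= hd|[s1 [v [w [s2 [es h]]]]]];
  first lia.
  move: ys => /= /andP[_ cs]; apply: (path_below_side pI cs) => // z hz.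
  by case/andP: hd => _ /path_down_bounds /(_ z hz); lia.
case/orP: h => /andP[hs vw]; first by case: (dir _ _ _ _ es hs).
rewrite es in ys us.
have [ys1 pv] : path (fun a b => cov p dn up b a) y s1 /\ cov p dn up v (last y s1).
  by move: hs; rewrite rcons_path => /andP[].
have nwp : last y s1 != w.
  apply: contraTneq us => <-; rewrite -cat_cons cat_uniq.
  have -> : has [in y :: s1] [:: v, last y s1 & s2].
    by apply/hasP; exists (last y s1); rewrite ?mem_last // !inE eqxx orbT.
  by rewrite andbF.
have /andP[uv bv] : up v && btw (last y s1) v w.
  apply/negPn/negP => /negbTE /(cov_parent_uniq pI pv vw) e.
  by rewrite e eqxx in nwp.
have vy : p v < p y.
  have := path_down_bounds hs (z := y); rewrite mem_head last_rcons => /(_ isT).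
  have := us; rewrite /= mem_cat inE !negb_or => /andP[/and3P[_ + _] _].
  by move=> nyv; rewrite leq_eqVlt => /andP[/predU1P[/pI e|//]]; rewrite e eqxx in nyv.
(* After the turn, the path leaves v through a parent: this is the dual situation with a shorter
   path. *)
have e1 : (last w s2 < v) = (w < v).
  apply: (IH (opp_height p) up dn); rewrite ?cov_opp //.
  - have := congr1 size es; rewrite /= size_cat /=; clear -hm; lia.
  - exact: opp_height_inj.
  - move: ys; rewrite cat_path /= => /and3P[_ _ /andP[h1 h2]].
    rewrite !cov_opp orbC h1; apply: sub_path h2 => a b.
    by rewrite !cov_opp orbC.
  - by move: us; rewrite /= cat_uniq => /and4P[_ _ _].
(* The part before the turn stays above v, hence on one side of the upper wall of v. *)
have e2 : (last y s1 < v) = (y < v).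
  apply: (path_below_side (opp_height_inj pI) (dn := up) (up := dn)) => //.
    by apply: sub_path ys1 => a b; rewrite !cov_opp => ->.
  move=> z hz; rewrite opp_height_lt.
  have h1 : p v < p (last y s1) := cov_lt pv.
  by have := path_down_bounds ys1 hz; clear -h1; lia.
have e3 : (v < y) = (c < y).
  case: s1 hs es {ys us nwp bv pv e2 ys1} => [|c' s1] hs [ec es]; first by rewrite ec.
  subst c'; move: hs => /= /andP[_ hs].
  rewrite -[X in nat_of_ord X < _](last_rcons c s1 v).
  apply: (path_below_side pI (dn := dn) (up := up)) => //.
    by apply: sub_path hs => a b ->; rewrite orbT.
  by move=> z /(path_down_bounds hs); clear -pcy; lia.
have -> : last c s = last w s2.
  by have := congr1 (last y) es; rewrite last_cat.
have nv : v != last w s2.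
  move: us; rewrite /= cat_uniq => /and4P[_ _ _ /andP[+ _]].
  by apply: contraNneq => ->; rewrite mem_last.
have nvy : v != y by apply: contraTneq vy => ->; rewrite ltnn.
(* The label v separates y from the end of the path, so this end is on the same side of y as v,
   which is the side of c by [e3]. *)
move: bv nv nvy; rewrite -!val_eqE /= -e3 /btw; clear -e1 e2.
lia.
Qed.

(** * The graph of covers is a permutree *)

Section Subtrees.

Variables (n : nat) (E : {set 'I_n * 'I_n}).
Implicit Types (i j k : 'I_n).

Lemma adjacentC : symmetric (adjacent E).
Proof. by move=> i j; rewrite /adjacent orbC. Qed.

Lemma subtree_path i j k : i != j -> k \in subtree E i j ->
  exists s, [/\ path (adjacent E) j s, last j s = k & uniq (i :: j :: s)].
Proof.
move=> nij; rewrite inE => /connectP[s /shortenP[s' hs us _ ->]].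
exists s'; split=> //; first by apply: sub_path hs => x y /= /and3P[].
rewrite cons_uniq us andbT; elim: s' j nij hs {us} => [|x s' IH] j nij /=.
  by rewrite inE.
rewrite inE negb_or nij => /andP[/and3P[_ _ nxi] hs].
by apply: IH; rewrite // eq_sym.
Qed.

End Subtrees.

Section CoverTree.

Variables (n : nat) (p : 'I_n -> nat) (dn up : pred 'I_n).
Hypothesis pI : injective p.
Implicit Types x y z b : 'I_n.
Local Notation cov := (cov p dn up).

Definition cover_arcs : {set 'I_n * 'I_n} := [set a | cov a.1 a.2].

Lemma mem_cover_arcs x y : ((x, y) \in cover_arcs) = cov x y.
Proof. by rewrite inE. Qed.

Lemma adjacent_cover : adjacent cover_arcs =2 (fun x y => cov x y || cov y x).
Proof. by move=> x y; rewrite /adjacent !mem_cover_arcs. Qed.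

(** The two neighbors of the highest vertex y of a cycle are distinct children of y, hence on
    opposite sides of its lower wall. The rest of the cycle joins them while avoiding y, against
    [cov_side]. *)
Lemma cover_arcs_acyclic c : 2 < size c -> ~~ ucycleb (adjacent cover_arcs) c.
Proof.
case: c => // x0 c0 sc; apply/negP=> uc.
have [y yc ymax] := @arg_maxnP _ x0 (mem (x0 :: c0)) p (mem_head _ _).
have [i s es] := rot_to yc.
have {uc} : ucycle (adjacent cover_arcs) (y :: s) by rewrite -es rot_ucycle.
have {}ymax z : z \in s -> cov z y || cov y z -> cov z y.
  move=> zs /orP[//|/cov_lt h].
  have /ymax : z \in x0 :: c0 by rewrite -(mem_rot i) es in_cons zs orbT.
  by rewrite /= leqNgt h.
have {}sc : 1 < size s by rewrite -(size_rot i) es in sc.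
case: s sc ymax {es} => // c s; rewrite ltnS => sc ymax.
case/andP=> /= /andP[yc1]; rewrite rcons_path => /andP[hs sy] us.
have cy : cov c y by apply: ymax; rewrite ?mem_head // orbC -adjacent_cover.
have ly : cov (last c s) y by apply: ymax; rewrite ?mem_last // -adjacent_cover.
have ncl : c != last c s.
  case: s sc us {hs sy ymax ly} => // d s _ /and3P[_ + _].
  by rewrite /=; apply: contraNneq => ->; rewrite mem_last.
have /andP[dy by_] : dn y && btw c y (last c s).
  apply: contraNT ncl => /negbTE h.
  by apply/eqP; apply: (cov_child_uniq pI cy ly).
have h : path (fun a b => cov a b || cov b a) y (c :: s).
  by rewrite -(eq_path adjacent_cover) /= yc1.
have := cov_side pI h us dy cy.
by case/orP: by_ => /andP[h1 h2]; rewrite h1 ltnNge (ltnW h2).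
Qed.

Lemma cover_connected x y : connect (adjacent cover_arcs) x y.
Proof.
have sym : connect_sym (adjacent cover_arcs).
  by apply: sym_connect_sym => a b; rewrite adjacentC.
wlog le_xy : x y / x <= y => [IH|].
  by case/orP: (leq_total x y) => /IH //; rewrite sym.
have step (a b : 'I_n) : a.+1 = b :> nat -> connect (adjacent cover_arcs) a b.
  move=> ab; wlog: a b {ab} / (a.+1 == b) || (b.+1 == a) => [IH|ab].
    by apply: IH; rewrite ab eqxx.
  have nab : a != b by apply: contraTneq ab => ->; clear; lia.
  wlog lt_ab : a b ab nab / p a < p b => [IH|].
    case: (ltngtP (p a) (p b)) => [||/pI e]; first exact: IH.
      by rewrite sym; apply: IH; rewrite 1?orbC // eq_sym.
    by rewrite e eqxx in nab.
  have /prec_connect : prec p dn up a b by apply: prec_succ.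
  by apply: connect_sub => u v uv; rewrite connect1 // adjacent_cover uv.
have [m] := ubnP (y - x); elim: m y le_xy => // m IH y le_xy hm.
case: (ltngtP x y) le_xy => // [lt|/val_inj->]; last by rewrite connect0.
have hy : y.-1 < n by have := ltn_ord y; lia.
move=> _; apply: connect_trans (IH (Ordinal hy) _ _) (step _ _ _) => /=; lia.
Qed.

Lemma cover_arcs_tree : directed_tree cover_arcs.
Proof.
apply/and3P; split.
- apply/'forall_forallP=> i j; apply/implyP; rewrite !mem_cover_arcs => /cov_lt h.
  by apply/negP=> /cov_lt; lia.
- by apply/'forall_forallP=> i j; apply: cover_connected.
- apply/'forall_forallP=> k c; apply/implyP=> hk.
  by apply: cover_arcs_acyclic; rewrite size_tuple.
Qed.

Lemma cover_children_valid y : valid_neighbors cover_arcs y (dn y) (children cover_arcs y).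
Proof.
rewrite /valid_neighbors; case: ifP => dy; last first.
  apply/card_le1_eqP => a b; rewrite !inE /= => ay cby.
  by apply: (cov_child_uniq pI cby ay); rewrite dy.
have side a k : cov a y -> k \in subtree cover_arcs y a -> (k < y) = (a < y) /\ k != y.
  move=> ay; have nya : y != a by apply: contraTneq (cov_lt ay) => ->; rewrite ltnn.
  case/(subtree_path nya) => s [hs <- us]; split.
    have h : path (fun x y => cov x y || cov y x) y (a :: s).
      by rewrite /= ay orbT -(eq_path adjacent_cover).
    exact: (cov_side pI h us dy ay).
  by case/andP: us => + _; apply: contraNneq => <-; rewrite mem_last.
apply/and4P; split.
- apply/card_le1_eqP => a b; rewrite !inE /= => /andP[ay lay] /andP[cby lby].
  by apply: (cov_child_uniq pI cby ay); rewrite dy /btw; clear -lay lby; lia.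
- apply/card_le1_eqP => a b; rewrite !inE /= => /andP[ay lay] /andP[cby lby].
  by apply: (cov_child_uniq pI cby ay); rewrite dy /btw; clear -lay lby; lia.
- apply/'forall_implyP=> a; rewrite inE mem_cover_arcs => ay.
  apply/implyP=> lay; apply/forallP=> k; apply/implyP=> /(side _ _ ay)[-> _].
  by [].
- apply/'forall_implyP=> a; rewrite inE mem_cover_arcs => ay.
  apply/implyP=> lay; apply/forallP=> k; apply/implyP=> /(side _ _ ay)[].
  by rewrite -val_eqE /=; clear -lay; lia.
Qed.

End CoverTree.

Lemma valid_neighbors_adjacent n (E E' : {set 'I_n * 'I_n}) i two nbrs :
  adjacent E =2 adjacent E' ->
  valid_neighbors E i two nbrs = valid_neighbors E' i two nbrs.
Proof.
move=> e; have es j : subtree E i j = subtree E' i j.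
  by apply/setP=> k; rewrite !inE; apply: eq_connect => a b /=; rewrite e.
rewrite /valid_neighbors; case: two => //.
by congr [&& _, _, _ & _]; apply: eq_forallb => j; rewrite es.
Qed.

Lemma cover_parents_valid n (p : 'I_n -> nat) dn up y : injective p ->
  valid_neighbors (cover_arcs p dn up) y (up y) (parents (cover_arcs p dn up) y).
Proof.
move=> pI; have := cover_children_valid up dn (opp_height_inj pI) y.
have -> : children (cover_arcs (opp_height p) up dn) y =
          parents (cover_arcs p dn up) y.
  by apply/setP=> z; rewrite !inE cov_opp.
rewrite (@valid_neighbors_adjacent _ _ (cover_arcs p dn up)) // => a b.
by rewrite !adjacent_cover !cov_opp orbC.
Qed.

(** * The insertion map *)

Section InsertionCovers.

Variables (n : nat) (delta : 'I_n -> decoration) (tau : 'S_n).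
Implicit Types (x y z b : 'I_n).

Definition dn x : bool := has_down (delta x).
Definition up x : bool := has_up (delta x).
Definition height x : nat := pos tau x.

Local Notation p := height.

Lemma height_inj : injective p.
Proof. by move=> x y /val_inj /perm_inj. Qed.

(** The test made by [origin], taken just after x is swept: the strand in the gap [g] is then one
    that x creates. *)
Definition touch (g : nat) x : bool :=
  same_interval delta tau (p x).+1 g x || same_interval delta tau (p x).+1 g x.+1.

Lemma originP t g :
  match origin delta tau t g with
  | Some x => [/\ p x < t, touch g x & forall z, p x < p z < t -> ~~ touch g z]
  | None => forall z, p z < t -> ~~ touch g z
  end.
Proof.
elim: t => [|t IH] //=; case: pickP => [x /andP[/eqP px hx]|nx].
  rewrite /p px; split=> [||z]; rewrite /touch /p ?px //; lia.
have {}nx z : p z = t -> ~~ touch g z.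
  by move=> e; have := nx z; rewrite /touch /p in e *; rewrite e eqxx /= => ->.
case: (origin delta tau t g) IH => [x [h1 h2 h3]|h].
  split=> // [|z hz]; first by apply: ltnW.
  by case: (eqVneq (p z) t) => [/nx//|ne]; apply: h3; clear -hz ne; lia.
move=> z; rewrite ltnS leq_eqVlt => /predU1P[/nx//|]; exact: h.
Qed.

Lemma origin_someP t g x :
  origin delta tau t g = Some x <->
  [/\ p x < t, touch g x & forall z, p x < p z < t -> ~~ touch g z].
Proof.
split=> [e|[h1 h2 h3]]; first by have := originP t g; rewrite e.
have := originP t g; case: origin => [y [k1 k2 k3]|/(_ x h1)]; last by rewrite h2.
case: (ltngtP (p x) (p y)) => [lt|lt|/height_inj->//].
- by have := h3 y; rewrite lt k1 k2 => /(_ isT).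
- by have := k3 x; rewrite lt h1 h2 => /(_ isT).
Qed.

Lemma no_wallP x g h :
  reflect (forall b, minn g h <= b < maxn g h -> b != x ->
             (dn b -> p b < p x) /\ (up b -> p x < p b))
    ([forall b : 'I_n, (b != x) ==> wall delta tau (p x).+1 b ==>
        ~~ (minn g h <= b < maxn g h)]).
Proof.
apply: (iffP forallP) => h0 b.
  move=> hb nbx; have := h0 b; rewrite nbx hb /wall -/(dn b) -/(up b) -/(p b).
  have : p b != p x by apply: contraNneq nbx => /height_inj->.
  by case: ltnP; case: (dn b); case: (up b) => //=; lia.
apply/implyP=> nbx; apply/implyP=> wb; apply/negP=> hb; have := h0 b hb nbx.
move: wb; rewrite /wall -/(dn b) -/(up b) -/(p b).
by case: ltnP => h1 h2; rewrite h2 => -[h3 h4];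
  [have := h3 isT|have := h4 isT]; lia.
Qed.

Lemma same_interval_avoid x g h : ~~ (minn g h <= x < maxn g h) ->
  same_interval delta tau (p x).+1 g h =
  [forall b : 'I_n, (b != x) ==> wall delta tau (p x).+1 b ==>
        ~~ (minn g h <= b < maxn g h)].
Proof.
move=> hx; apply: eq_forallb => b.
by case: eqVneq => //= ->; rewrite hx implybT.
Qed.

Lemma same_interval_sub t g h g' h' :
  minn g h <= minn g' h' -> maxn g' h' <= maxn g h ->
  same_interval delta tau t g h -> same_interval delta tau t g' h'.
Proof.
move=> h1 h2 /forallP hs; apply/forallP=> k; apply/implyP=> /(implyP (hs k)).
by apply: contra; lia.
Qed.

(** The gap [y] lies just to the left of the vertex y. From x on the left, only the labels strictly
    between x and y intervene; from x on the right, so does y itself, whose lower wall still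
    stands. *)
Lemma touch_left x y : p x < p y ->
  touch y x <-> vis p dn up x y /\ ~~ (dn y && (y < x)).
Proof.
move=> xy; case: (ord_ltgt x y) => [lt|lt|e]; last by rewrite e ltnn in xy.
- have -> : touch y x = same_interval delta tau (p x).+1 y x.+1.
    apply/orP/idP => [[|//]|]; last by right.
    by apply: same_interval_sub; lia.
  rewrite same_interval_avoid; last by lia.
  split=> [/no_wallP h|[[_ h] _]].
    split; last by lia.
    split=> // b hb; apply: h; first by rewrite /btw in hb; lia.
    by apply: contraTneq hb => ->; rewrite /btw; lia.
  apply/no_wallP => b hb _; apply: h; rewrite /btw; lia.
- have -> : touch y x = same_interval delta tau (p x).+1 y x.
    apply/orP/idP => [[//|]|]; last by left.
    by apply: same_interval_sub; lia.
  rewrite same_interval_avoid; last by lia.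
  split=> [/no_wallP h|[[_ h] h']].
    split; last first.
      have nyx : y != x by apply: contraTneq lt => ->; rewrite ltnn.
      have [] := h y _ nyx; first lia.
      by case: (dn y) => // /(_ isT); lia.
    split=> // b hb; apply: h; first by rewrite /btw in hb; lia.
    by apply: contraTneq hb => ->; rewrite /btw; lia.
  apply/no_wallP => b hb _; case: (eqVneq b y) => [->|nby].
    by move: h'; rewrite lt andbT => /negbTE->; split.
  by apply: h; move: nby; rewrite -val_eqE /btw /=; lia.
Qed.

Lemma touch_right x y : p x < p y ->
  touch y.+1 x <-> vis p dn up x y /\ ~~ (dn y && (x < y)).
Proof.
move=> xy; case: (ord_ltgt x y) => [lt|lt|e]; last by rewrite e ltnn in xy.
- have -> : touch y.+1 x = same_interval delta tau (p x).+1 y.+1 x.+1.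
    apply/orP/idP => [[|//]|]; last by right.
    by apply: same_interval_sub; lia.
  rewrite same_interval_avoid; last by lia.
  split=> [/no_wallP h|[[_ h] h']].
    split; last first.
      have nyx : y != x by apply: contraTneq lt => ->; rewrite ltnn.
      have [] := h y _ nyx; first lia.
      by case: (dn y) => // /(_ isT); lia.
    split=> // b hb; apply: h; first by rewrite /btw in hb; lia.
    by apply: contraTneq hb => ->; rewrite /btw; lia.
  apply/no_wallP => b hb _; case: (eqVneq b y) => [->|nby].
    by move: h'; rewrite lt andbT => /negbTE->; split.
  by apply: h; move: nby; rewrite -val_eqE /btw /=; lia.
- have -> : touch y.+1 x = same_interval delta tau (p x).+1 y.+1 x.
    apply/orP/idP => [[//|]|]; last by left.
    by apply: same_interval_sub; lia.
  rewrite same_interval_avoid; last by lia.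
  split=> [/no_wallP h|[[_ h] _]].
    split; last by lia.
    split=> // b hb; apply: h; first by rewrite /btw in hb; lia.
    by apply: contraTneq hb => ->; rewrite /btw; lia.
  apply/no_wallP => b hb _; apply: h; rewrite /btw; lia.
Qed.

(** The creator of a strand caught by y is the last vertex to touch the gap beside y; by
    [touch_left] and [touch_right] it is the last to see y from that side, as in [cov_visP]. *)
Lemma insertion_cover : insertion delta tau = cover_arcs p dn up.
Proof.
apply/setP=> -[x y]; rewrite mem_cover_arcs inE /=.
apply/orP/idP => [h|/(cov_visP _ _ _ _ height_inj)[v later]].
  apply/(cov_visP _ _ _ _ height_inj).
  case: h => /eqP/origin_someP[xy].
    move=> /(touch_left xy)[v hx] later; split=> // z xz vz; have zy := proj1 vz.
    have := later z; rewrite xz zy => /(_ isT)/negP ntz.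
    have /andP[dy yz] : dn y && (y < z).
      by apply/negPn/negP=> h; apply: ntz; apply/(touch_left zy).
    move: hx; rewrite dy /btw yz; case: (ord_ltgt x y) => [->//|->//|e].
    by rewrite e ltnn in xy.
  move=> /(touch_right xy)[v hx] later; split=> // z xz vz; have zy := proj1 vz.
  have := later z; rewrite xz zy => /(_ isT)/negP ntz.
  have /andP[dy yz] : dn y && (z < y).
    by apply/negPn/negP=> h; apply: ntz; apply/(touch_right zy).
  move: hx; rewrite dy /btw yz; case: (ord_ltgt x y) => [->//|->|e].
    by rewrite orbT.
  by rewrite e ltnn in xy.
have xy := proj1 v.
case: (ord_ltgt x y) => [lt|lt|e]; last by rewrite e ltnn in xy.
- left; apply/eqP/origin_someP; split=> //.
    by apply/(touch_left xy); split=> //; lia.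
  move=> z /andP[xz zy]; apply/negP => /(touch_left zy)[vz].
  by have := later z xz vz; rewrite /btw; lia.
- right; apply/eqP/origin_someP; split=> //.
    by apply/(touch_right xy); split=> //; lia.
  move=> z /andP[xz zy]; apply/negP => /(touch_right zy)[vz].
  by have := later z xz vz; rewrite /btw; lia.
Qed.

Lemma insertion_permutree : is_permutree delta (insertion delta tau).
Proof.
rewrite insertion_cover; apply/and3P; split.
- exact: cover_arcs_tree height_inj.
- by apply/forallP=> i; apply: cover_parents_valid height_inj.
- by apply/forallP=> i; apply: cover_children_valid height_inj _.
Qed.

End InsertionCovers.

(** * Permutrees and their linear extensions *)

Section TreeArcs.

Variable n : nat.
Implicit Types (E : {set 'I_n * 'I_n}) (i j k x y : 'I_n).

Lemma directed_tree_antisym E i j : directed_tree E ->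
  (i, j) \in E -> (j, i) \notin E.
Proof. by case/and3P=> /'forall_forallP/(_ i j)/implyP. Qed.

Lemma directed_tree_connect E i j : directed_tree E -> connect (adjacent E) i j.
Proof. by case/and3P=> _ /'forall_forallP/(_ i j). Qed.

Lemma directed_tree_acyclic E c : directed_tree E -> 2 < size c ->
  ~~ ucycleb (adjacent E) c.
Proof.
case/and3P=> _ _ /forallP h sc; apply/negP=> uc.
have hs : size c < n.+1.
  case/andP: uc => _ /card_uniqP <-; rewrite ltnS -[X in _ <= X]card_ord.
  exact: max_card.
have := h (Ordinal hs) => /forallP/(_ (in_tuple c)); rewrite /= sc.
by rewrite uc.
Qed.

Lemma adjacent_path E x y : connect (adjacent E) x y ->
  exists s, [/\ path (adjacent E) x s, last x s = y & uniq (x :: s)].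
Proof. by case/connectP=> s /shortenP[s' hs us _ ->]; exists s'. Qed.

(** An arc of [E'] missing from [E] would close a cycle with a path of [E]. Thanks to this, one
    inclusion suffices to identify two trees. *)
Lemma connected_sub_tree E E' : E \subset E' ->
  (forall x y, connect (adjacent E) x y) -> directed_tree E' -> E = E'.
Proof.
move=> /subsetP sEE' conn tE'; apply/setP=> -[x y]; apply/idP/idP; first exact: sEE'.
move=> xy; have [[|z s]] := adjacent_path (conn x y); rewrite /=.
  by move=> [_ e _]; subst; have := directed_tree_antisym tE' xy; rewrite xy.
have nyx := directed_tree_antisym tE' xy.
case: s => [|t s] [hs ls us].
  move: hs ls => /= /[swap] ->; rewrite andbT => /orP[//|/sEE'].
  by rewrite (negbTE nyx).
have := @directed_tree_acyclic _ [:: x, z, t & s] tE' isT.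
case/negP; apply/andP; split=> //.
have sub : subrel (adjacent E) (adjacent E').
  by move=> a b /orP[] /sEE' h; rewrite /adjacent h ?orbT.
move: hs ls => /= /and3P[/sub h1 /sub h2 /(sub_path sub) h3] ls.
by rewrite h1 h2 rcons_path h3 ls /adjacent xy orbT.
Qed.

Lemma path_subtree E i j s k : path (adjacent E) j s -> i \notin j :: s ->
  k \in j :: s -> k \in subtree E i j.
Proof.
move=> hs us /splitPl hk; case: hk hs us => s1 s2 <-.
rewrite cat_path => /andP[+ _] us; rewrite inE.
have {us} : i \notin j :: s1 by apply: contra us; rewrite -cat_cons mem_cat => ->.
elim: s1 j => //= t s1 IH j; rewrite !inE !negb_or.
move=> /and3P[ij it is1] /andP[jt ts1].
apply: connect_trans (IH t _ ts1); last by rewrite inE negb_or it is1.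
by rewrite connect1 //= jt eq_sym ij eq_sym.
Qed.

Lemma path_subtree_last E i j s : path (adjacent E) j s -> i \notin j :: s ->
  j \in subtree E i (last j s).
Proof.
move=> hs us; have := path_subtree hs us (mem_last j s); rewrite !inE.
rewrite sym_connect_sym // => a b /=; rewrite adjacentC.
by congr (_ && _); apply: andbC.
Qed.

Section Neighbors.

Variables (E : {set 'I_n * 'I_n}) (v : 'I_n) (two : bool) (nbrs : {set 'I_n}).
Hypothesis valid : valid_neighbors E v two nbrs.

Lemma neighbor_side a k : two -> a \in nbrs -> a != v -> k \in subtree E v a ->
  (k < v) = (a < v) /\ k != v.
Proof.
move: valid; rewrite /valid_neighbors => + t; rewrite t.
case/and4P=> _ _ /'forall_implyP/(_ a) lo /'forall_implyP/(_ a) hi an nav ka.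
have [lt|lt|e] := ord_ltgt a v; last by rewrite e eqxx in nav.
  have /implyP/(_ lt)/'forall_implyP/(_ k ka) := lo an.
  by rewrite lt -val_eqE /=; lia.
have /implyP/(_ lt)/'forall_implyP/(_ k ka) := hi an.
by rewrite -val_eqE /=; lia.
Qed.

(** Distinct parents (or children) exist only where v has a wall, with at most one on each side, and
    their subtrees stay on their sides. *)
Lemma neighbor_opposite a b k l : a \in nbrs -> b \in nbrs -> a != b ->
  a != v -> b != v -> k \in subtree E v a -> l \in subtree E v b ->
  two /\ btw k v l.
Proof.
move=> an bn nab nav nbv ka lb; have t : two.
  apply: contraNT nab => /negbTE t; move: valid; rewrite /valid_neighbors t.
  by move/card_le1_eqP => /(_ a b an bn) ->.
split=> //; have [k1 _] := neighbor_side t an nav ka.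
have [l1 _] := neighbor_side t bn nbv lb.
have [_ nkv] := neighbor_side t an nav ka; have [_ nlv] := neighbor_side t bn nbv lb.
suff : (a < v) != (b < v).
  move: nkv nlv; rewrite -k1 -l1 -!val_eqE /btw /=; clear; lia.
apply: contra nab => /eqP e; move: valid; rewrite /valid_neighbors t.
case/and4P=> /card_le1_eqP lo /card_le1_eqP hi _ _.
case: (ltnP a v) e => [av|va] e; apply/eqP.
  by apply: lo; rewrite inE ?an ?bn -?e.
move: nav nbv; rewrite -!val_eqE /= => nav nbv.
by apply: hi; rewrite inE ?an ?bn /=; clear -va e nav nbv; lia.
Qed.

End Neighbors.


Lemma neighbor_path E v two nbrs a s k : valid_neighbors E v two nbrs ->
  two -> a \in nbrs -> path (adjacent E) a s -> v \notin a :: s -> k \in a :: s ->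
  (k < v) = (a < v).
Proof.
move=> va t an hs vs ks; have nav : a != v.
  by apply: contraNneq vs => ->; rewrite mem_head.
by have [] := neighbor_side va t an nav (path_subtree hs vs ks).
Qed.

(** The case of a turn: the path enters and leaves v through neighbors of the same kind, so v
    separates its start from all that comes after v. *)
Lemma neighbor_opposite_path E v two nbrs x s1 w s2 k :
  valid_neighbors E v two nbrs ->
  path (adjacent E) x (s1 ++ v :: w :: s2) -> uniq (x :: s1 ++ v :: w :: s2) ->
  last x s1 \in nbrs -> w \in nbrs -> k \in w :: s2 ->
  two /\ btw x v k.
Proof.
move=> va; rewrite cat_path -cat_cons cat_uniq.
case/andP=> hs1 hs2 /and3P[us1 ns us2] ln wn ks2.
case/and3P: hs2 => _ vw hs2; case/and3P: us2 => vs2 ws2 us2.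
have vs1 : v \notin x :: s1.
  by apply: contra ns => h; apply/hasP; exists v; rewrite ?mem_head.
have ws1 : w \notin x :: s1.
  by apply: contra ns => h; apply/hasP; exists w; rewrite // !inE eqxx orbT.
apply: (neighbor_opposite va ln wn).
- by apply: contraNneq ws1 => <-; rewrite mem_last.
- by apply: contraNneq vs1 => <-; rewrite mem_last.
- by apply: contraNneq vs2 => <-; rewrite mem_head.
- exact: path_subtree_last hs1 vs1.
- exact: (path_subtree hs2 vs2 ks2).
Qed.

End TreeArcs.

Section LinearExtension.

Variables (n : nat) (delta : 'I_n -> decoration) (E : {set 'I_n * 'I_n}).
Variable p : 'I_n -> nat.
Hypotheses (pE : is_permutree delta E) (pI : injective p).
Hypothesis incr : forall x y, (x, y) \in E -> p x < p y.
Implicit Types x y z b : 'I_n.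

Local Notation arc := (fun x y => (x, y) \in E).
Local Notation dn := (dn delta).
Local Notation up := (up delta).

Let treeE : directed_tree E. Proof. by case/and3P: pE. Qed.

Let validP x : valid_neighbors E x (up x) (parents E x).
Proof. by case/and3P: pE => _ /forallP/(_ x). Qed.

Let validC x : valid_neighbors E x (dn x) (children E x).
Proof. by case/and3P: pE => _ _ /forallP/(_ x). Qed.

Lemma arc_path_lt x s z : path arc x s -> z \in s -> p x < p z.
Proof.
move=> /(sub_path (e' := fun a b => p a < p b)) h zs.
have /allP : all (fun z => p x < p z) s.
  apply: order_path_min (h _) => [? ? ?|]; [exact: ltn_trans | exact: incr].
exact.
Qed.

Lemma arc_opp_path_lt x s z : path (fun a b => arc b a) x s -> z \in s -> p z < p x.
Proof.
move=> /(sub_path (e' := fun a b => p b < p a)) h zs.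
have /allP : all (fun z => p z < p x) s.
  apply: order_path_min (h _) => [a b c h1 h2|a b]; last exact: incr.
  exact: ltn_trans h2 h1.
exact.
Qed.

Lemma turn_peak x s1 v w s2 k :
  path (adjacent E) x (s1 ++ v :: w :: s2) -> uniq (x :: s1 ++ v :: w :: s2) ->
  path arc x (rcons s1 v) -> (w, v) \in E -> k \in w :: s2 ->
  dn v /\ btw x v k.
Proof.
move=> hs us; rewrite rcons_path => /andP[_ h1] h2 hk.
by apply: (neighbor_opposite_path (validC v) hs us _ _ hk); rewrite inE.
Qed.

Lemma turn_valley x s1 v w s2 k :
  path (adjacent E) x (s1 ++ v :: w :: s2) -> uniq (x :: s1 ++ v :: w :: s2) ->
  path (fun a b => arc b a) x (rcons s1 v) -> (v, w) \in E -> k \in w :: s2 ->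
  up v /\ btw x v k.
Proof.
move=> hs us; rewrite rcons_path => /andP[_ h1] h2 hk.
by apply: (neighbor_opposite_path (validP v) hs us _ _ hk); rewrite inE.
Qed.

Lemma vis_connect x y : vis p dn up x y -> connect arc x y.
Proof.
case=> xy v; have [s [hs ls us]] := adjacent_path (directed_tree_connect x y treeE).
have ys : y \in s.
  by have := mem_last x s; rewrite ls inE => /predU1P[e|//]; rewrite e ltnn in xy.
case: (path_turn hs) => [h|/arc_opp_path_lt/(_ ys)|[s1 [t [w [s2 [es]]]]]].
- by apply/connectP; exists s.
- by clear -xy; lia.
rewrite es in hs ls us; have yw : y \in w :: s2.
  by rewrite -ls last_cat /= mem_last.
have tr : t \in rcons s1 t by rewrite mem_rcons mem_head.
case/orP=> /andP[h1 h2].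
  have [dt bt] := turn_peak hs us h1 h2 yw.
  have [/(_ dt) h3 _] := v t bt.
  by have := arc_path_lt h1 tr; clear -h3; lia.
have [ut bt] := turn_valley hs us h1 h2 yw.
have [_ /(_ ut) h3] := v t bt.
by have := arc_opp_path_lt h1 tr; clear -h3; lia.
Qed.

Lemma path_to_arc x y b : (x, y) \in E -> b != x -> b != y ->
  exists s u w, [/\ path (adjacent E) b (rcons (rcons s u) w),
    uniq (b :: rcons (rcons s u) w) & (u, w) = (x, y) \/ (u, w) = (y, x)].
Proof.
move=> xy nbx nby; have [s [hs ls us]] := adjacent_path (directed_tree_connect b x treeE).
have nxy : x != y by apply: contraTneq (incr xy) => ->; rewrite ltnn.
have [ys|ys] := boolP (y \in s).
  case/path.splitP: ys hs ls us => s1 s2; rewrite cat_path => /andP[hs1 _] ls.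
  rewrite -cat_cons cat_uniq => /and3P[us1 ns _].
  exists s1, y, x; split; last by right.
    by rewrite rcons_path hs1 last_rcons /adjacent xy orbT.
  rewrite -rcons_cons rcons_uniq us1 andbT; apply: contra ns => xs.
  apply/hasP; exists x => //; move: ls (mem_last y s2).
  by rewrite last_cat last_rcons => ->; rewrite inE (negbTE nxy).
case/lastP: s ys hs ls us => [|s u]; first by move=> _ _ /= e; rewrite e eqxx in nbx.
rewrite last_rcons => ys hs e us; subst u; exists s, x, y; split; last by left.
  by rewrite rcons_path hs last_rcons /adjacent xy.
by rewrite -rcons_cons rcons_uniq us andbT inE negb_or eq_sym nby.
Qed.

(* Take a simple path from b that ends with the arc x -> y. A turn would      *)
(* separate b from both x and y, so the path is monotone, and the wall of b   *)
(* only lets it leave on the other side of b.                                 *)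
Lemma arc_vis x y : (x, y) \in E -> vis p dn up x y.
Proof.
move=> xy; split=> [|b hb]; first exact: incr.
have nbx : b != x by apply: contraTneq hb => ->; rewrite /btw; clear; lia.
have nby : b != y by apply: contraTneq hb => ->; rewrite /btw; clear; lia.
have [s [u [w [hs us uw]]]] := path_to_arc xy nbx nby.
have uls : u \in rcons (rcons s u) w by rewrite mem_rcons inE mem_rcons mem_head orbT.
have wls : w \in rcons (rcons s u) w by rewrite mem_rcons mem_head.
have first c t : rcons (rcons s u) w = c :: t ->
    (c \in parents E b -> ~~ up b) /\ (c \in children E b -> ~~ dn b).
  move=> e; rewrite e in hs us uls wls.
  case/andP: hs => _ ht; case/andP: us => bt _.
  have side two nbrs : valid_neighbors E b two nbrs -> c \in nbrs -> ~~ two.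
    move=> vb cn; apply/negP=> t2.
    have h1 := neighbor_path vb t2 cn ht bt uls.
    have h2 := neighbor_path vb t2 cn ht bt wls.
    by move: hb; rewrite /btw; case: uw => -[? ?]; subst; clear -h1 h2; lia.
  by split; apply: side.
case: (path_turn hs) => [h|h|[s1 [t [v [s2 [es h]]]]]].
- have e : u = x /\ w = y.
    case: uw => -[? ?]; subst; first by split.
    move: h; rewrite rcons_path last_rcons => /andP[_ yx].
    by have := directed_tree_antisym treeE xy; rewrite yx.
  case: e => ? ?; subst; have bx := arc_path_lt h uls.
  case E1: (rcons _ _) h (first) => [|c t] /=; first by case: (s) E1.
  case/andP=> bc _ /(_ c t erefl)[+ _]; rewrite inE bc => /(_ isT)/negbTE->.
  by split.
- have e : u = y /\ w = x.
    case: uw => -[? ?]; subst; last by split.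
    move: h; rewrite rcons_path last_rcons => /andP[_ yx].
    by have := directed_tree_antisym treeE xy; rewrite yx.
  case: e => ? ?; subst; have bx := arc_opp_path_lt h wls.
  case E1: (rcons _ _) h (first) => [|c t] /=; first by case: (s) E1.
  case/andP=> bc _ /(_ c t erefl)[_ +]; rewrite inE bc => /(_ isT)/negbTE->.
  by split.
exfalso; rewrite es in hs us.
have opp k : k \in v :: s2 -> btw b t k.
  by move=> hk; case/orP: h => /andP[h1 h2];
    [case: (turn_peak hs us h1 h2 hk) | case: (turn_valley hs us h1 h2 hk)].
have /opp bw : w \in v :: s2.
  by have := congr1 (last b) es; rewrite last_rcons last_cat /= => ->; rewrite mem_last.
have : btw b t u \/ t = u.
  case/lastP: s2 es opp {hs us bw} => [|s2 w'] es opp.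
    right; move: es; rewrite -cat_rcons cats1 => /rcons_inj[+ _].
    by move/rcons_inj => [].
  left; apply: opp; move: es; rewrite -!rcons_cons -rcons_cat => /rcons_inj[es _].
  have := congr1 (last b) es; rewrite last_rcons last_cat /= => ->.
  by rewrite -rcons_cons mem_rcons inE mem_last orbT.
by move: hb bw; rewrite /btw; case: uw => -[? ?] hb bw [hu|hu]; subst;
  move: hb bw; try move: hu; clear; lia.
Qed.

(** A cover is visible, hence an increasing path of arcs. Each arc is itself a relation of [prec],
    so a path of several arcs would contradict covering. The other inclusion comes from
    [connected_sub_tree]. *)
Lemma permutree_cover_arcs : E = cover_arcs p dn up.
Proof.
symmetry; apply: (connected_sub_tree _ _ treeE); last exact: cover_connected.
apply/subsetP=> -[x y]; rewrite mem_cover_arcs => /[dup] cxy.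
case/(cov_visP _ _ _ _ pI)=> /vis_connect/connectP[[|z s]] /= hs ey _.
  by have := cov_lt cxy; rewrite ey ltnn.
case/andP: hs => xz hs; case: (eqVneq z y) => [<-//|nzy].
case/covP: cxy => _ /(_ z (vis_prec (arc_vis xz))) [].
elim: s z {xz} hs ey nzy => [|t s IH] z /= => [_ ->|/andP[zt hs] ey nzy].
  by rewrite eqxx.
have pzt := vis_prec (arc_vis zt).
by case: (eqVneq t y) => [<-//|nty]; apply: prec_trans pzt (IH _ hs ey nty).
Qed.

End LinearExtension.

(** * Adjacent transpositions and rotations *)

Lemma cov_ext n (p q : 'I_n -> nat) dn up :
  (forall x y, (p x < p y) = (q x < q y)) -> cov p dn up =2 cov q dn up.
Proof.
move=> e; have ep x y : prec p dn up x y = prec q dn up x y.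
  rewrite /prec e; congr [&& _, _ & _].
    by apply: eq_forallb => b; rewrite !e.
  by apply: eq_forallb => b; apply: eq_forallb => c; rewrite e.
by move=> x y; rewrite /cov ep; congr (_ && _); apply: eq_forallb => z; rewrite !ep.
Qed.

Section Swap.

Variables (n : nat) (p : 'I_n -> nat) (dn up : pred 'I_n) (i j : 'I_n).
Hypotheses (pI : injective p) (pij : p j = (p i).+1).
Implicit Types (x y z b : 'I_n).

Definition swap x : nat := p (tperm i j x).

Local Notation q := swap.

Lemma swap_inj : injective q.
Proof. by move=> x y /pI /perm_inj. Qed.

Lemma swap_left : q i = p j. Proof. by rewrite /q tpermL. Qed.
Lemma swap_right : q j = p i. Proof. by rewrite /q tpermR. Qed.

Lemma swap_lt x y : x != i -> x != j ->
  (q x < q y) = (p x < p y) /\ (q y < q x) = (p y < p x).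
Proof.
move=> xi xj; rewrite /q [tperm _ _ x]tpermD // 1?eq_sym //.
have hi : p x != p i by apply: contraNneq xi => /pI->.
have hj : p x != p j by apply: contraNneq xj => /pI->.
by move: hi hj pij; case: tpermP => [->|->|//]; clear; lia.
Qed.

Lemma vis_swap x y : x != i -> x != j -> vis q dn up x y <-> vis p dn up x y.
Proof.
move=> xi xj; rewrite /vis (swap_lt y xi xj).1.
by split=> -[h1 h2]; split=> // b /h2; have [-> ->] := swap_lt b xi xj.
Qed.

Lemma swap_ltl x y : x != i -> x != j -> (q x < q y) = (p x < p y).
Proof. by move=> xi xj; case: (swap_lt y xi xj). Qed.

Lemma swap_ltr x y : x != i -> x != j -> (q y < q x) = (p y < p x).
Proof. by move=> xi xj; case: (swap_lt y xi xj). Qed.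

Lemma swap_lt_pair x y : (x, y) != (i, j) -> (x, y) != (j, i) ->
  (q x < q y) = (p x < p y).
Proof.
move=> nij nji.
have [xij|/norP[xi xj]] := boolP ((x == i) || (x == j)); last exact: swap_ltl.
have [yij|/norP[yi yj]] := boolP ((y == i) || (y == j)); last exact: swap_ltr.
move: nij nji.
by case/pred2P: xij => ->; case/pred2P: yij => ->; rewrite ?eqxx ?ltnn.
Qed.

Lemma height_neq x : x != i -> x != j -> (p x == p i) = false /\ (p x == p j) = false.
Proof. by rewrite !(inj_eq pI) => /negbTE-> /negbTE->. Qed.

(** The hypotheses leave out i -> j and the arcs that a rotation reattaches: those leaving j, or
    entering i, with no wall of that vertex separating their other end from i and j. *)
Lemma cov_swap x y : cov p dn up x y -> (x, y) != (i, j) ->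
  (x = j -> up j && btw i j y) -> (y = i -> dn i && btw x i j) ->
  cov q dn up x y.
Proof.
move=> /(cov_visP _ _ _ _ pI)[vxy later] nij hx hy.
apply/(cov_visP _ _ _ _ swap_inj).
have pxy := proj1 vxy; have [_ v] := vxy.
have [exi|nxi] := eqVneq x i.
  subst x; have nyj : y != j by apply: contraNneq nij => ->.
  have nyi : y != i by apply: contraTneq pxy => ->; rewrite ltnn.
  have [hpi hpj] := height_neq nyi nyj.
  (* Otherwise j, swept right after i, would also see y, and y would not cover i. *)
  have nb : ~~ btw i j y.
    apply/negP=> hb; have vj : vis p dn up j y.
      split=> [|b hb']; first by clear -pxy pij hpj; lia.
      have [h1 h2] : (dn b -> p b < p i) /\ (up b -> p i < p b).
        by apply: v; move: hb hb'; rewrite /btw; clear; lia.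
      have : p b != p j by apply: contraTneq hb' => /pI->; rewrite /btw; clear; lia.
      by move: h1 h2 pij; clear; lia.
    have := later j _ vj; rewrite pij ltnSn => /(_ isT).
    by move: hb; rewrite /btw; clear; lia.
  split=> [|z qz].
    split=> [|b hb]; first by rewrite (swap_ltr _ nyi nyj).
    have nbj : b != j by apply: contraNneq nb => <-.
    have nbi : b != i by apply: contraTneq hb => ->; rewrite /btw; clear; lia.
    by rewrite (swap_ltl _ nbi nbj) (swap_ltr _ nbi nbj); apply: v.
  have nzi : z != i by apply: contraTneq qz => ->; rewrite ltnn.
  have nzj : z != j.
    by apply: contraTneq qz => ->; rewrite swap_left swap_right pij; clear; lia.
  by rewrite (vis_swap _ nzi nzj); apply: later; rewrite -(swap_ltr _ nzi nzj).
have [exj|nxj] := eqVneq x j.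
  subst x; have /andP[uj bj] := hx erefl.
  have nyj : y != j by apply: contraTneq pxy => ->; rewrite ltnn.
  have nyi : y != i by apply: contraTneq bj => ->; rewrite /btw; clear; lia.
  split=> [|z qz].
    split=> [|b hb]; first by rewrite (swap_ltr _ nyi nyj).
    have nbj : b != j by apply: contraTneq hb => ->; rewrite /btw; clear; lia.
    have nbi : b != i by apply: contraTneq hb => ->; move: bj; rewrite /btw; clear; lia.
    by rewrite (swap_ltl _ nbi nbj) (swap_ltr _ nbi nbj); apply: v.
  have nzj : z != j by apply: contraTneq qz => ->; rewrite ltnn.
  have [->|nzi] := eqVneq z i.
    by case=> _ /(_ j bj)[_ /(_ uj)]; rewrite swap_left swap_right; clear -pij; lia.
  by rewrite (vis_swap _ nzi nzj); apply: later; rewrite -(swap_ltr _ nzi nzj).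
split=> [|z]; first by rewrite vis_swap.
rewrite swap_ltl // => pz.
(* Only i and j can be new competitors of x. If one of them sees y after the exchange, then it or
   the other one, when that one lies on the way to y, saw y before. *)
have [ezi|nzi] := eqVneq z i.
  subst z => -[qy w].
  have nyi : y != i by apply: contraTneq qy => ->; rewrite ltnn.
  have nyj : y != j.
    by apply: contraTneq qy => ->; rewrite swap_left swap_right; clear -pij; lia.
  have [_ hpj] := height_neq nyi nyj.
  have piy : p i < p y by rewrite -(swap_ltr _ nyi nyj).
  have w' b : b != j -> btw i b y -> (dn b -> p b < p i) /\ (up b -> p i < p b).
    move=> nbj hb; have nbi : b != i by apply: contraTneq hb => ->; rewrite /btw; clear; lia.
    by rewrite -(swap_ltl _ nbi nbj) -(swap_ltr _ nbi nbj); apply: w.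
  have [hb|hb] := boolP (btw i j y).
    have pxj : p x < p j by rewrite pij ltnW.
    have vj : vis p dn up j y.
      split=> [|b hb']; first by clear -piy pij hpj; lia.
      have nbj : b != j by apply: contraTneq hb' => ->; rewrite /btw; clear; lia.
      have [h1 h2] : (dn b -> p b < p i) /\ (up b -> p i < p b).
        by apply: w' => //; move: hb hb'; rewrite /btw; clear; lia.
      have : p b != p j by rewrite (inj_eq pI).
      by move: h1 h2 pij; clear; lia.
    by have := later j pxj vj; move: hb; rewrite /btw; clear; lia.
  apply: later => //; split=> // b hb'; apply: w' => //.
  by apply: contraNneq hb => <-.
have [ezj|nzj] := eqVneq z j; last by rewrite vis_swap //; apply: later.
subst z => -[qy w].
have [_ hpj] := height_neq nxi nxj.
have pxi : p x < p i.
  have [hpi _] := height_neq nxi nxj.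
  by move: pz hpi pij; clear; lia.
have nyj : y != j by apply: contraTneq qy => ->; rewrite ltnn.
have [eyi|nyi] := eqVneq y i; first by rewrite eyi; apply: hy.
have [hpi {}hpj] := height_neq nyi nyj.
have pjy : p j < p y by rewrite -(swap_ltr _ nyi nyj).
have piy : p i < p y by move: pjy pij; clear; lia.
have w' b : b != i -> btw j b y -> (dn b -> p b < p i) /\ (up b -> p i < p b).
  move=> nbi hb; have nbj : b != j by apply: contraTneq hb => ->; rewrite /btw; clear; lia.
  have [hbi _] := height_neq nbi nbj.
  have := w b hb; rewrite (swap_ltl _ nbi nbj) (swap_ltr _ nbi nbj).
  by move: hbi pij; clear; lia.
have [hb|hb] := boolP (btw j i y).
  have vi : vis p dn up i y.
    split=> // b hb'; have nbi : b != i.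
      by apply: contraTneq hb' => ->; rewrite /btw; clear; lia.
    by apply: w' => //; move: hb hb'; rewrite /btw; clear; lia.
  by have := later i pxi vi; move: hb; rewrite /btw; clear; lia.
apply: later => //; split=> // b hb'.
have nbi : b != i by apply: contraNneq hb => <-.
have nbj : b != j by apply: contraTneq hb' => ->; rewrite /btw; clear; lia.
have [_ hbj] := height_neq nbi nbj.
by have := w' b nbi hb'; move: hbj pij; clear; lia.
Qed.

Lemma cov_swap_rev : cov p dn up i j -> cov q dn up j i.
Proof.
move=> /(cov_unwalled pI)[_ c]; apply/(cov_visP _ _ _ _ swap_inj).
split=> [|z h1 [h2 _]]; last first.
  by have := h1; have := h2; rewrite swap_left swap_right /q; case: tpermP; clear -pij; lia.
split=> [|b]; first by rewrite swap_left swap_right pij.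
rewrite btwC => hb.
have nbi : b != i by apply: contraTneq hb => ->; rewrite /btw; clear; lia.
have nbj : b != j by apply: contraTneq hb => ->; rewrite /btw; clear; lia.
have [hpi hpj] := height_neq nbi nbj.
rewrite (swap_ltl _ nbi nbj) (swap_ltr _ nbi nbj).
by have := c b hb; move: pij; clear; lia.
Qed.

Lemma cov_swap_parent a : cov p dn up i j -> cov p dn up j a ->
  ~~ (up j && btw i j a) -> cov q dn up i a.
Proof.
move=> /(cov_unwalled pI)[_ c] /(cov_visP _ _ _ _ pI)[[pja v] later] h.
have naj : a != j by apply: contraTneq pja => ->; rewrite ltnn.
have nai : a != i by apply: contraTneq pja => ->; rewrite pij; clear; lia.
have nij : i != j by apply: contra_eq_neq pij => ->; clear; lia.
apply/(cov_visP _ _ _ _ swap_inj); split=> [|z qz].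
  split=> [|b hb]; first by rewrite (swap_ltr _ nai naj); move: pja pij; clear; lia.
  have nbi : b != i by apply: contraTneq hb => ->; rewrite /btw; clear; lia.
  have [ebj|nbj] := eqVneq b j.
    by move: h; rewrite -ebj hb andbT => /negbTE->; rewrite ebj swap_left swap_right pij.
  rewrite (swap_ltl _ nbi nbj) (swap_ltr _ nbi nbj).
  have [hpi hpj] := height_neq nbi nbj.
  have [hb'|hb'] := boolP (btw i b j).
    by have := c b hb'; move: pij; clear; lia.
  have hb2 : btw j b a.
    by move: hb hb' nbj; rewrite -val_eqE /btw /=; clear; lia.
  by have := v b hb2; move: hpi pij; clear; lia.
have nzi : z != i by apply: contraTneq qz => ->; rewrite ltnn.
have nzj : z != j.
  by apply: contraTneq qz => ->; rewrite swap_left swap_right pij; clear; lia.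
rewrite (vis_swap _ nzi nzj) => vz; have [_ hpj] := height_neq nzi nzj.
have pz : p j < p z.
  by move: qz; rewrite (swap_ltr _ nzi nzj) => pz; move: pz pij hpj; clear; lia.
have /andP[da bz] := later z pz vz; rewrite da /=.
have : ~~ btw i a j.
  by apply/negP=> /c[/(_ da)]; move: pja pij; clear; lia.
by move: bz nai; rewrite -val_eqE /btw /=; clear; lia.
Qed.

End Swap.

Lemma cov_swap_child n (p : 'I_n -> nat) dn up i j b :
    injective p -> p j = (p i).+1 ->
  cov p dn up i j -> cov p dn up b i -> ~~ (dn i && btw j i b) ->
  cov (swap p i j) dn up b j.
Proof.
move=> pI pij cij cbi h.
have hij : opp_height p i = (opp_height p j).+1.
  rewrite /opp_height pij; have := leq_bigmax (F := p) j.
  by rewrite pij; lia.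
have := cov_swap_parent (opp_height_inj pI) hij (dn := up) (up := dn) (a := b).
rewrite !cov_opp => /(_ cij cbi h) hc.
rewrite -cov_opp -(@cov_ext _ (swap (opp_height p) j i)) // => x y.
by rewrite opp_height_lt /swap opp_height_lt tpermC.
Qed.

Section Rotation.

Variables (n : nat) (delta : 'I_n -> decoration) (p : 'I_n -> nat) (i j : 'I_n).
Local Notation dn := (dn delta).
Local Notation up := (up delta).
Hypotheses (pI : injective p) (pij : p j = (p i).+1) (lij : i < j).
Hypothesis cij : cov p dn up i j.
Local Notation E := (cover_arcs p dn up).
Local Notation E' := (rotate delta E i j).

Lemma rotate_sub : E' \subset cover_arcs (swap p i j) dn up.
Proof.
apply/subsetP=> -[x y]; rewrite mem_cover_arcs !in_setU in_setD !in_setU !in_set1.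
rewrite mem_cover_arcs !negb_or -!orbA.
case/or4P=> [/andP[/andP[/andP[nij nA] nB] cxy]|/eqP[-> ->]|/imsetP[a + [-> ->]]|
             /imsetP[b + [-> ->]]].
- apply: (cov_swap pI pij cxy nij) => e; subst.
    apply: contraNT nA => h; apply/imsetP; exists y => //.
    have nyj : y != j by apply: contraTneq (cov_lt cxy) => ->; rewrite ltnn.
    rewrite !inE cxy /= -/(up j); move: h nyj lij; rewrite -val_eqE /btw /=.
    by clear; lia.
  apply: contraNT nB => h; apply/imsetP; exists x => //.
  have nxi : x != i by apply: contraTneq (cov_lt cxy) => ->; rewrite ltnn.
  rewrite !inE cxy /= -/(dn i); move: h nxi lij; rewrite -val_eqE /btw /=.
  by clear; lia.
- exact: cov_swap_rev.
- rewrite !inE => /andP[cja h]; apply: (cov_swap_parent pI pij cij cja).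
  by move: h; rewrite /= -/(up j) /btw; move: lij; clear; lia.
- rewrite !inE => /andP[cbi h]; apply: (cov_swap_child pI pij cij cbi).
  by move: h; rewrite /= -/(dn i) /btw; move: lij; clear; lia.
Qed.

(** An arc of E survives, is reversed, or is replaced by a detour of two arcs through j -> i. *)
Lemma rotate_connected x y : connect (adjacent E') x y.
Proof.
have sym : connect_sym (adjacent E').
  by apply: sym_connect_sym => a b; rewrite adjacentC.
have mem a b : (a, b) \in E' -> connect (adjacent E') a b.
  by move=> h; rewrite connect1 // /adjacent h.
have ji : connect (adjacent E') j i by apply: mem; rewrite !inE eqxx orbT.
have arc a b : (a, b) \in E -> connect (adjacent E') a b.
  move=> ab; have [|nr] := boolP ((a, b) \in [set (i, j)]
    :|: [set (j, a) | a in rotA delta E j]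
    :|: [set (b, i) | b in rotB delta E i]); last first.
    by apply: mem; rewrite in_setU in_setD nr ab.
  rewrite !in_setU in_set1 => /orP[/orP[/eqP[-> ->]|]|]; first by rewrite sym.
    case/imsetP=> c hc [-> ->]; apply: connect_trans ji (mem _ _ _).
    by rewrite !in_setU (imset_f (fun a => (i, a)) hc) !orbT.
  case/imsetP=> c hc [-> ->]; apply: connect_trans (mem _ j _) ji.
  by rewrite !in_setU (imset_f (fun b => (b, j)) hc) !orbT.
have := cover_connected dn up pI x y; apply: connect_sub => a b.
by case/orP=> /arc; rewrite // sym.
Qed.

Lemma rotate_cover : E' = cover_arcs (swap p i j) dn up.
Proof.
apply: (connected_sub_tree rotate_sub rotate_connected).
exact: cover_arcs_tree (swap_inj pI).
Qed.

End Rotation.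

(** * Linear extensions *)

Section Orders.

Variable n : nat.
Implicit Types (x y z : 'I_n) (sigma tau : 'S_n).

Lemma perm_of_order (r : rel 'I_n) : irreflexive r -> transitive r ->
  (forall x y, x != y -> r x y || r y x) ->
  exists tau, forall x y, (height tau x < height tau y) = r x y.
Proof.
move=> irr tr tot; pose rank x := #|[set y | r y x]|.
have rank_lt x y : r x y -> rank x < rank y.
  move=> xy; apply/proper_card/properP; split.
    by apply/subsetP=> z; rewrite !inE => /tr; apply.
  by exists x; rewrite inE ?xy ?irr.
have rank_bound x : rank x < n.
  rewrite -[X in _ < X]card_ord -cardsT; apply/proper_card/properP; split.
    exact: subsetT.
  by exists x; rewrite !inE ?irr.
pose s x := Ordinal (rank_bound x).
have s_inj : injective s.
  move=> x y [e]; apply/eqP; apply: contraT => /tot /orP[] /rank_lt;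
  by rewrite e ltnn.
exists (perm s_inj)^-1%g => x y.
rewrite /height /pos invgK !permE /=.
apply/idP/idP => [lt|]; last exact: rank_lt.
have [e|/tot/orP[//|/rank_lt]] := eqVneq x y; first by rewrite e ltnn in lt.
by move: lt; clear; lia.
Qed.

Lemma perm_of_levels (c p : 'I_n -> nat) : injective p ->
  exists tau, forall x y, (height tau x < height tau y) =
                          (c x < c y) || (c x == c y) && (p x < p y).
Proof.
move=> pI; apply: perm_of_order => [x|y x z|x y nxy]; [clear; lia | clear; lia |].
by move: nxy; rewrite -(inj_eq pI); clear; lia.
Qed.

(** Inversion sets are the closed and coclosed sets of pairs: both conditions together make the
    natural order, reversed on [I], transitive. *)
Lemma perm_of_inversions (I : rel 'I_n) :
    (forall x y z, x < y < z -> I x y -> I y z -> I x z) ->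
    (forall x y z, x < y < z -> I x z -> I x y || I y z) ->
  exists tau, forall x y, x < y -> (height tau y < height tau x) = I x y.
Proof.
move=> tr ctr; pose r x y := (x < y) && ~~ I x y || (y < x) && I y x.
have [||x y nxy|tau ht] := @perm_of_order r.
- by move=> x; rewrite /r ltnn.
- move=> y x z; rewrite /r.
  case/orP=> /andP[xy Ixy] /orP[]/andP[yz Iyz].
  + by move: (ctr x y z) xy yz Ixy Iyz; clear; lia.
  + have [xz|xz|e] := ord_ltgt x z; last by subst z; rewrite Iyz in Ixy.
      by move: (tr x z y) xy yz xz Ixy Iyz; clear; lia.
    by move: (ctr z x y) xy yz xz Ixy Iyz; clear; lia.
  + have [xz|xz|e] := ord_ltgt x z; last by subst z; rewrite Ixy in Iyz.
      by move: (tr y x z) xy yz xz Ixy Iyz; clear; lia.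
    by move: (ctr y z x) xy yz xz Ixy Iyz; clear; lia.
  + by move: (tr z y x) xy yz Ixy Iyz; clear; lia.
- rewrite /r; have [h|h|e] := ord_ltgt x y; last by rewrite e eqxx in nxy.
    by move: h; clear; lia.
  by move: h; clear; lia.
exists tau => x y xy; rewrite ht /r xy.
by rewrite ltnNge ltnW.
Qed.

Lemma weak_leP sigma tau : reflect
  (forall x y, x < y ->
     height sigma y < height sigma x -> height tau y < height tau x)
  (weak_le sigma tau).
Proof.
apply: (iffP subsetP) => h.
  by move=> x y xy hs; have := h (x, y); rewrite !inE /= xy hs => /(_ isT).
by move=> [x y]; rewrite !inE /= => /andP[xy /(h _ _ xy)]; rewrite xy.
Qed.

Lemma height_lt_inj sigma tau :
  (forall x y, (height sigma x < height sigma y) = (height tau x < height tau y)) ->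
  sigma = tau.
Proof.
move=> e; suff h x : height sigma x = height tau x.
  apply: invg_inj; apply/permP=> x; apply: val_inj; exact: h.
have rankE rho : height rho x = #|[set y | height rho y < height rho x]|.
  rewrite -[LHS]card_ord; symmetry.
  have -> : [set y | height rho y < height rho x] =
      [set rho (widen_ord (ltnW (ltn_ord (pos rho x))) k) | k : 'I_(height rho x)].
    apply/setP=> y; rewrite inE; apply/idP/imsetP => [lt|[k _ ->]].
      exists (Ordinal lt) => //.
      have -> : widen_ord (ltnW (ltn_ord (pos rho x))) (Ordinal lt) = pos rho y.
        exact: val_inj.
      by rewrite /pos permKV.
    by rewrite {1}/height /pos permK /=.
  rewrite card_imset // => a b /perm_inj /(congr1 val) /= ab.
  exact: val_inj.
by rewrite (rankE sigma) (rankE tau); apply: eq_card => y; rewrite !inE e.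
Qed.

Lemma weak_anti : antisymmetric (@weak_le n).
Proof.
move=> sigma tau /andP[/weak_leP st /weak_leP ts]; apply: height_lt_inj => x y.
have lt_total (rho : 'S_n) (a b : 'I_n) : a != b ->
    (height rho a < height rho b) = ~~ (height rho b < height rho a).
  by move=> nab; rewrite -leqNgt ltn_neqAle (inj_eq (@height_inj n rho)) nab.
have e (a b : 'I_n) : a < b ->
    (height sigma b < height sigma a) = (height tau b < height tau a).
  by move=> ab; apply/idP/idP; [apply: st | apply: ts].
have [xy|xy|->] := ord_ltgt x y; last by rewrite !ltnn.
  have nxy : x != y by rewrite -val_eqE neq_ltn xy.
  by rewrite !(lt_total _ _ _ nxy) e.
exact: e.
Qed.

Lemma weak_refl : reflexive (@weak_le n).
Proof. by move=> s; apply: subxx. Qed.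

Lemma weak_trans : transitive (@weak_le n).
Proof. by move=> y x z; apply: subset_trans. Qed.

Lemma height_surj sigma m : m < n -> exists x, height sigma x = m.
Proof.
by move=> lt; exists (sigma (Ordinal lt)); rewrite /height /pos permK.
Qed.

Lemma height_tperm sigma i j x :
  height (sigma * tperm i j)%g x = swap (height sigma) i j x.
Proof. by rewrite /swap /height /pos invMg tpermV permM. Qed.

End Orders.

Section LinearExtensions.

Variables (n : nat) (delta : 'I_n -> decoration) (E : {set 'I_n * 'I_n}).
Hypothesis pE : is_permutree delta E.
Implicit Types x y z : 'I_n.

Local Notation arc := (fun x y => (x, y) \in E).

Lemma arc_acyclic x y : (x, y) \in E -> ~~ connect arc y x.
Proof.
have tE : directed_tree E by case/and3P: pE.
move=> xy; apply/negP=> /connectP[s /shortenP[{}s hs us _ es]].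
case: s hs us es => [|z [|t s]] /= hs us es.
- by move: xy (directed_tree_antisym tE xy); rewrite es => ->.
- by move: (directed_tree_antisym tE xy); rewrite es; case/andP: hs => ->.
have := @directed_tree_acyclic _ _ [:: y, z, t & s] tE isT.
case/negP; apply/andP; split=> //.
have sub : subrel arc (adjacent E) by move=> a b h; rewrite /adjacent h.
case/and3P: hs => /sub h1 /sub h2 /(sub_path sub) h3.
by rewrite /= h1 h2 rcons_path h3 -es /adjacent xy.
Qed.

Lemma linear_extension :
  exists tau : 'S_n, forall x y, (x, y) \in E -> height tau x < height tau y.
Proof.
(* Counting descendants gives a function that increases strictly along the arcs. *)
pose depth x := #|[set z | connect arc z x]|.
have depth_lt x y : (x, y) \in E -> depth x < depth y.
  move=> xy; apply/proper_card/properP; split.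
    apply/subsetP=> z; rewrite !inE => /connect_trans; apply.
    exact: connect1.
  by exists y; rewrite inE ?connect0 // arc_acyclic.
have [tau ht] := perm_of_levels depth (@ord_inj n).
by exists tau => x y /depth_lt lt; rewrite ht lt.
Qed.

Lemma connect_prec (p : 'I_n -> nat) dn up x y : connect (cov p dn up) x y ->
  (x == y) || prec p dn up x y.
Proof.
case/connectP=> s; elim: s x => [|z s IH] x /= => [_ ->|/andP[xz hs] ey].
  by rewrite eqxx.
have xz' : prec p dn up x z by case/covP: xz.
by case/predU1P: (IH z hs ey) => [<-|/(prec_trans xz') ->]; rewrite ?xz' orbT.
Qed.

(** Any linear extension is sorted again by levels: the other descendants of j, then i, j and the
    rest. It remains one because i -> j is a cover, so no other descendant of j lies above i. *)
Lemma adjacent_linear_extension i j : (i, j) \in E ->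
  exists2 tau : 'S_n, forall x y, (x, y) \in E -> height tau x < height tau y
    & height tau j = (height tau i).+1.
Proof.
move=> ij; have [tau0 lin] := linear_extension.
have eE := permutree_cover_arcs pE (@height_inj n tau0) lin.
set p := height tau0 in lin eE.
have pI : injective p by apply: height_inj.
pose below x := [&& connect arc x j, x != i & x != j].
pose level x := if below x then 0 else if x == i then 1
                else if x == j then 2 else 3.
have [tau ht] := perm_of_levels level pI.
have nij : i != j by apply: contraTneq (lin _ _ ij) => ->; rewrite ltnn.
have bi : below i = false by rewrite /below eqxx andbF.
have bj : below j = false by rewrite /below eqxx !andbF.
have li : level i = 1 by rewrite /level bi eqxx.
have lj : level j = 2 by rewrite /level bj eqxx eq_sym (negbTE nij).
have cpr a b : connect arc a b -> (a == b) || prec p (dn delta) (up delta) a b.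
  move=> h; apply: connect_prec; move: h; apply: connect_sub => u v uv.
  by rewrite connect1 // -mem_cover_arcs -eE.
have cij : cov p (dn delta) (up delta) i j by rewrite -mem_cover_arcs -eE.
have lintau x y : (x, y) \in E -> height tau x < height tau y.
  move=> xy; rewrite ht; have pxy := lin _ _ xy; rewrite pxy andbT orbC -leq_eqVlt.
  have nxj : connect arc y j -> x != j.
    move/cpr => h; apply: contraTneq pxy => exj; rewrite exj -leqNgt.
    by case/predU1P: h => [->//|/prec_lt/ltnW].
  have jbelow : connect arc y j -> (x == i) || below x.
    move=> h; rewrite /below nxj // andbT; case: (x == i) => //=.
    by rewrite andbT; apply: connect_trans h; apply: connect1.
  have [yi|nyi] := eqVneq y i.
    have /jbelow : connect arc y j by rewrite yi connect1.
    have nxi : x != i by apply: contraTneq pxy => ->; rewrite yi ltnn.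
    by rewrite (negbTE nxi) /= /level => ->.
  have [yj|nyj] := eqVneq y j.
    have /jbelow : connect arc y j by rewrite yj connect0.
    rewrite yj lj => /predU1P[->|bx]; first by rewrite li.
    by rewrite /level bx.
  have [by_|by_] := boolP (below y); last first.
    rewrite /level (negbTE by_) (negbTE nyi) (negbTE nyj).
    by case: ifP => // _; case: ifP => // _; case: ifP.
  have [cy _ _] := and3P by_.
  case/predU1P: (jbelow cy) => [xi|bx]; last by rewrite /level bx.
  subst x; case/covP: cij => _ /(_ y) [].
    by case/predU1P: (cpr i y (connect1 xy)) => // e; rewrite e eqxx in nyi.
  by case/predU1P: (cpr _ _ cy) => // e; rewrite e eqxx in nyj.
exists tau => //; have lt := lintau _ _ ij.
apply/eqP; rewrite eqn_leq lt andbT leqNgt; apply/negP=> lt2.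
have hn : (height tau i).+1 < n by apply: ltn_trans lt2 (ltn_ord _).
have [k hk] := height_surj tau hn.
have ik : height tau i < height tau k by rewrite hk.
have kj : height tau k < height tau j by rewrite hk.
have nki : k != i by apply: contraTneq ik => ->; rewrite ltnn.
have nkj : k != j by apply: contraTneq kj => ->; rewrite ltnn.
move: ik kj; rewrite !ht li lj /level (negbTE nki) (negbTE nkj).
by case: ifP.
Qed.

End LinearExtensions.

(** * Lattices *)

Section AbstractLattices.

(** By finiteness, the meet is the join of all common lower bounds, with [bot] as the empty join. *)
Lemma bounded_join_lattice (T : finType) (le : rel T) (bot : T) :
    reflexive le -> antisymmetric le -> transitive le -> (forall x, le bot x) ->
    (forall x y, exists z, is_join le x y z) ->
  is_lattice le.
Proof.
move=> refl anti trans le_bot join; split=> // x y.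
have sup (s : seq T) : exists z, {in s, forall u, le u z} /\
    forall v, {in s, forall u, le u v} -> le z v.
  elim: s => [|a s [z [ub lub]]]; first by exists bot; split=> // u; rewrite in_nil.
  have [w [aw zw wl]] := join a z; exists w; split=> [u|v hv].
    by rewrite in_cons => /predU1P[->//|/ub/trans]; apply.
  apply: wl; first by apply: hv; rewrite mem_head.
  by apply: lub => u us; apply: hv; rewrite in_cons us orbT.
have [z [ub lub]] := sup (enum [pred u | le u x && le u y]).
exists z; split.
- by apply: lub => u; rewrite mem_enum => /andP[].
- by apply: lub => u; rewrite mem_enum => /andP[].
- by move=> u ux uy; apply: ub; rewrite mem_enum inE ux uy.
Qed.

(** The last two hypotheses provide least and greatest preimages, that is, a left and a right
    adjoint that are sections of f. The right one makes f preserve joins, the left one makes it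
    preserve meets and also gives the antisymmetry of [leT]. *)
Lemma adjoint_lattice_homomorphism (S T : Type) (leS : rel S) (leT : rel T)
    (f : S -> T) :
    is_lattice leS -> reflexive leT -> transitive leT ->
    (forall x y, leS x y -> leT (f x) (f y)) ->
    (forall t, exists2 x, f x = t & forall y, leT t (f y) -> leS x y) ->
    (forall t, exists2 x, f x = t & forall y, leT (f y) t -> leS y x) ->
  lattice_homomorphism leS leT f.
Proof.
move=> latS reflT transT mono lo hi; have [reflS antiS transS joinS meetS] := latS.
have fjoin x y z : is_join leS x y z -> is_join leT (f x) (f y) (f z).
  case=> xz yz lub; split; [exact: mono|exact: mono|] => t.
  by have [u <- hu] := hi t => /hu xu /hu yu; apply: mono; apply: lub.
have fmeet x y z : is_meet leS x y z -> is_meet leT (f x) (f y) (f z).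
  case=> zx zy glb; split; [exact: mono|exact: mono|] => t.
  by have [u <- hu] := lo t => /hu ux /hu uy; apply: mono; apply: glb.
split=> //; split=> //.
- move=> s t /andP[st ts]; have [x fx lx] := lo s; have [y fy ly] := lo t.
  rewrite -fx -fy; congr f; apply: antiS; rewrite lx ?fy //.
  by rewrite ly // fx.
- move=> s t; have [x <- _] := lo s; have [y <- _] := lo t.
  by have [z /fjoin] := joinS x y; exists (f z).
- move=> s t; have [x <- _] := lo s; have [y <- _] := lo t.
  by have [z /fmeet] := meetS x y; exists (f z).
Qed.

End AbstractLattices.

(** * The weak order: joins and covers *)

Section WeakOrder.

Variable n : nat.
Implicit Types (sigma tau : 'S_n) (x y z : 'I_n).

(** The inversions of the join are the transitive closure of the union. It stays coclosed: given y
    between the ends of a chain, either y is on the chain or the step that jumps over y splits at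
    y. *)
Lemma weak_join sigma tau : exists rho, is_join (@weak_le n) sigma tau rho.
Proof.
pose inv sigma x y := height sigma y < height sigma x.
pose R : rel 'I_n := fun x y => (x < y) && (inv sigma x y || inv tau x y).
have invD rho x y z : inv rho x z -> inv rho x y || inv rho y z.
  by rewrite /inv; clear; lia.
have [||rho hr] := @perm_of_inversions n (connect R).
- by move=> x y z _; apply: connect_trans.
- move=> x y z + /connectP[s hs ez]; elim: s x hs ez => [|w s IH] x /=.
    by move=> _ ->; clear; lia.
  case/andP=> xw hs ez /andP[xy yz].
  have wz : connect R w z by apply/connectP; exists s.
  have [lt|lt|e] := ord_ltgt y w; last by rewrite e connect1.
    case/andP: xw => _ /orP[] /invD-/(_ y)/orP[h|h].
    + by rewrite connect1 // /R xy h.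
    + by rewrite (connect_trans (connect1 _) wz) ?orbT // /R lt h.
    + by rewrite connect1 // /R xy h orbT.
    + by rewrite (connect_trans (connect1 _) wz) ?orbT // /R lt h orbT.
  have /orP[wy|->] : connect R w y || connect R y z.
    by apply: IH => //; rewrite lt yz.
    by rewrite (connect_trans (connect1 xw) wy).
  by rewrite orbT.
exists rho; split.
- by apply/weak_leP=> x y xy h; rewrite hr // connect1 // /R xy /inv h.
- by apply/weak_leP=> x y xy h; rewrite hr // connect1 // /R xy /inv h orbT.
move=> u /weak_leP su /weak_leP tu; apply/weak_leP=> x y xy; rewrite hr //.
case/connectP=> s; elim: s x {xy} (xy) => [|w s IH] x xy /=.
  by move=> _ e; rewrite e ltnn in xy.
case/andP=> /andP[xw h] hs ey.
have uw : height u w < height u x by case/orP: h; [apply: su|apply: tu].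
have [lt|lt|<-//] := ord_ltgt w y; first exact: ltn_trans (IH w lt hs ey) uw.
suff : w <= y by rewrite leqNgt lt.
rewrite ey; elim: s w hs {IH xw h ey uw lt} => //= v s IH w /andP[/andP[wv _]].
by move/IH; apply: leq_trans; apply: ltnW.
Qed.

Lemma weak_lattice : is_lattice (@weak_le n).
Proof.
apply: (@bounded_join_lattice _ _ 1%g).
- exact: weak_refl.
- exact: weak_anti.
- exact: weak_trans.
- move=> tau; apply/weak_leP=> x y xy.
  by rewrite /height /pos invg1 !perm1 ltnNge ltnW.
- exact: weak_join.
Qed.

Lemma height_lt_total sigma x y : x != y -> ~~ (height sigma y < height sigma x) ->
  height sigma x < height sigma y.
Proof. by rewrite -leqNgt ltn_neqAle (inj_eq (@height_inj n sigma)) => ->. Qed.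

Lemma weak_le_tperm sigma (i j : 'I_n) : i < j -> height sigma j = (height sigma i).+1 ->
  weak_le sigma (sigma * tperm i j)%g.
Proof.
move=> lij adj; apply/weak_leP=> x y xy; rewrite !height_tperm.
have [[-> ->]|nij] := eqVneq (x, y) (i, j).
  by rewrite swap_left swap_right adj.
rewrite (swap_lt_pair (@height_inj n sigma) adj) //.
  by apply: contraTneq xy => -[-> ->]; rewrite -leqNgt ltnW.
by apply: contraNneq nij => -[-> ->].
Qed.

(** If [tau] kept the order of every two consecutive values of [sigma], they would be equal. A
    consecutive pair that [tau] reverses must be increasing in labels, as [tau] keeps the inversions
    of [sigma]. *)
Lemma weak_adjacent sigma tau : weak_le sigma tau -> sigma != tau ->
  exists i j : 'I_n, [/\ i < j, height sigma j = (height sigma i).+1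
                & weak_le (sigma * tperm i j)%g tau].
Proof.
move=> /weak_leP st nst.
have [/existsP[i /existsP[j /andP[/eqP ij h]]]|/existsPn no] :=
  boolP [exists i : 'I_n, exists j : 'I_n, (height sigma j == (height sigma i).+1)
                             && (height tau j < height tau i)].
  have lij : i < j.
    have [//|ji|e] := ord_ltgt i j; last by rewrite e ltnn in h.
    by have := st j i ji; rewrite ij ltnSn => /(_ isT); move: h; clear; lia.
  exists i, j; split=> //; apply/weak_leP=> x y xy; rewrite !height_tperm.
  have sI := @height_inj n sigma.
  have [[-> ->] //|nij] := eqVneq (x, y) (i, j).
  rewrite (swap_lt_pair sI ij); first exact: st.
    by apply: contraTneq xy => -[-> ->]; rewrite -leqNgt ltnW.
  by apply: contraNneq nij => -[-> ->].
case/eqP: nst; apply: height_lt_inj.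
have mono m x y : height sigma y = height sigma x + m.+1 -> height tau x < height tau y.
  elim: m y => [|m IH] y e.
    have := no x; rewrite negb_exists => /forallP/(_ y); rewrite e addn1 eqxx /=.
    apply: height_lt_total; apply: contra_eq_neq e => ->; clear; lia.
  have [z hz] : exists z, height sigma z = height sigma x + m.+1.
    apply: height_surj; have := ltn_ord (pos sigma y).
    by rewrite -/(height sigma y) e; clear; lia.
  apply: ltn_trans (IH z hz) _.
  have := no z; rewrite negb_exists => /forallP/(_ y); rewrite e hz addnS eqxx /=.
  apply: height_lt_total; apply: contra_eq_neq e => <-; rewrite hz; clear; lia.
have {}mono x y : height sigma x < height sigma y -> height tau x < height tau y.
  by move=> lt; apply: (mono (height sigma y - height sigma x).-1); move: lt; clear; lia.
move=> x y; apply/idP/idP => [|h]; first exact: mono.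
apply: height_lt_total; first by apply: contraTneq h => ->; rewrite ltnn.
by apply/negP => /mono; move: h; clear; lia.
Qed.

End WeakOrder.

(** A curve from x to y passes over or under b; it can be bent to start from b in the first case, to
    end at b in the second. *)
Lemma prec_between n (p : 'I_n -> nat) dn up (x y b : 'I_n) : injective p ->
  prec p dn up x y -> btw x b y -> prec p dn up x b || prec p dn up b y.
Proof.
move=> pI /precP[h1 h2 h3] hb.
(* The curve is forced over b: it starts higher than b, or has to climb a lower wall whose top is
   higher than b. *)
pose late := (p b < p x) || [exists d : 'I_n, [&& btw x d b, dn d & p b < p d]].
have [hl|hl] := boolP late; apply/orP; [right|left]; apply/precP.
  have [d [pd dy dup]] : exists d : 'I_n, [/\ p b < p d, p d < p y &
      forall c : 'I_n, btw b c y -> up c -> p d < p c].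
    case/orP: hl => [bx|/existsP[d /and3P[xdb dd bd]]].
      exists x; split=> // c hc uc; have [] := h2 c; last by move=> _ /(_ uc).
      by move: hb hc; rewrite /btw; clear; lia.
    have xdy : btw x d y by move: hb xdb; rewrite /btw; clear; lia.
    exists d; split=> //; first by case: (h2 d xdy) => /(_ dd).
    by move=> c hc uc; apply: h3 => //; move: hb xdb hc; rewrite /btw; clear; lia.
  split; first exact: ltn_trans pd dy.
    move=> c hc; have [h4 _] : (dn c -> p c < p y) /\ (up c -> p x < p c).
      by apply: h2; move: hb hc; rewrite /btw; clear; lia.
    by split=> // uc; apply: ltn_trans pd (dup c hc uc).
  by move=> c e hc he; apply: h3; move: hb hc he; rewrite /btw; clear; lia.
have /norP[nbx /existsPn nl] := hl.
have nxb : p x != p b.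
  by rewrite (inj_eq pI); apply: contraTneq hb => ->; rewrite /btw; clear; lia.
split; first by move: nbx nxb; clear; lia.
  move=> c hc; have [_ h4] : (dn c -> p c < p y) /\ (up c -> p x < p c).
    by apply: h2; move: hb hc; rewrite /btw; clear; lia.
  split=> // dc; have := nl c; rewrite hc dc /=.
  have : p c != p b.
    by rewrite (inj_eq pI); apply: contraTneq hc => ->; rewrite /btw; clear; lia.
  by clear; lia.
by move=> c e hc he; apply: h3; move: hb hc he; rewrite /btw; clear; lia.
Qed.

(** * The permutree lattice through extremal linear extensions *)

Section PermutreeLattice.

Variables (n : nat) (delta : 'I_n -> decoration).
Implicit Types (sigma tau : 'S_n) (x y z : 'I_n) (T : permutree delta).

Local Notation dn := (dn delta).
Local Notation up := (up delta).

Definition to_permutree tau : permutree delta :=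
  Permutree (insertion_permutree delta tau).

Local Notation P := to_permutree.

Definition below T x y : bool :=
  (x != y) && connect (fun a b => (a, b) \in arcs T) x y.

Lemma arcs_permutree T : is_permutree delta (arcs T).
Proof. by case: T. Qed.

Lemma to_permutree_linear T tau :
  (forall x y, (x, y) \in arcs T -> height tau x < height tau y) -> P tau = T.
Proof.
move=> lin; apply: val_inj; rewrite /= insertion_cover.
by rewrite -(permutree_cover_arcs (arcs_permutree T) (@height_inj n tau) lin).
Qed.

Lemma to_permutree_surj T : exists tau, P tau = T.
Proof.
have [tau lin] := linear_extension (arcs_permutree T).
by exists tau; apply: to_permutree_linear.
Qed.

Lemma below_prec tau x y : below (P tau) x y = prec (height tau) dn up x y.
Proof.
have e : connect (fun a b => (a, b) \in arcs (P tau)) =2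
    connect (cov (height tau) dn up).
  by apply: eq_connect => a b; rewrite /= insertion_cover mem_cover_arcs.
rewrite /below e; apply/andP/idP => [[nxy /connect_prec/predU1P[h|//]]|h].
  by rewrite h eqxx in nxy.
split; last exact: prec_connect.
by apply: contraTneq (prec_lt h) => ->; rewrite ltnn.
Qed.

(** Every inequality in [prec] compares two labels lying in the same direction as its two arguments,
    so a decreasing relation is a conjunction of inversions and an increasing one of
    noninversions. *)
Lemma weak_below sigma tau x y : weak_le sigma tau -> x < y ->
  (below (P sigma) y x -> below (P tau) y x) /\
  (below (P tau) x y -> below (P sigma) x y).
Proof.
move=> /weak_leP st xy; rewrite !below_prec.
have ts (a b : 'I_n) : a < b -> height tau a < height tau b ->
    height sigma a < height sigma b.
  move=> ab h; apply: height_lt_total.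
    by apply: contraTneq ab => ->; rewrite ltnn.
  by apply/negP => /(st _ _ ab); move: h; clear; lia.
split=> /precP[h1 h2 h3]; apply/precP; split.
- exact: st.
- move=> b hb; have [h4 h5] := h2 b hb; have : x < b < y.
    by move: hb xy; rewrite /btw; clear; lia.
  by case/andP=> xb by_; split=> [/h4|/h5]; apply: st.
- move=> b c hb hc db uc; apply: st; last exact: h3.
  by move: hb hc xy; rewrite /btw; clear; lia.
- exact: ts.
- move=> b hb; have [h4 h5] := h2 b hb; have : x < b < y.
    by move: hb xy; rewrite /btw; clear; lia.
  by case/andP=> xb by_; split=> [/h4|/h5]; apply: ts.
- move=> b c hb hc db uc; apply: ts; last exact: h3.
  by move: hb hc xy; rewrite /btw; clear; lia.
Qed.

Lemma rotation_weak T T' : increasing_rotation T T' ->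
  exists sigma tau, [/\ P sigma = T, P tau = T' & weak_le sigma tau].
Proof.
case/existsP=> i /existsP[j /and3P[lij ij /eqP eT']].
have [sigma lin adj] := adjacent_linear_extension (arcs_permutree T) ij.
have sI := @height_inj n sigma.
exists sigma, (sigma * tperm i j)%g; split; first exact: to_permutree_linear.
  apply: val_inj => /=; rewrite eT' insertion_cover.
  have eT := permutree_cover_arcs (arcs_permutree T) sI lin.
  rewrite eT in ij *; rewrite (@rotate_cover _ _ (height sigma)) //.
    apply/setP=> -[x y]; rewrite !mem_cover_arcs; apply: cov_ext => a b.
    by rewrite !height_tperm.
  by rewrite -mem_cover_arcs.
exact: weak_le_tperm.
Qed.

Lemma permutree_le_below T T' x y : permutree_le T T' -> x < y ->
  (below T y x -> below T' y x) /\ (below T' x y -> below T x y).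
Proof.
move=> + xy; case/connectP=> s; elim: s T => [|T1 s IH] T /= => [_ ->//|].
case/andP=> /rotation_weak[sigma [tau [<- <- st]]] hs e.
have [h1 h2] := IH _ hs e; have [h3 h4] := weak_below st xy.
by split=> [/h3/h1|/h2/h4].
Qed.

(** Climb to [tau] by exchanges of consecutive values i < j. If i -> j is an arc, the exchange
    rotates it; otherwise the new permutation is still a linear extension of the same tree. *)
Lemma weak_permutree_le sigma tau : weak_le sigma tau -> permutree_le (P sigma) (P tau).
Proof.
have [m] := ubnP (#|inversions tau| - #|inversions sigma|).
elim: m sigma => // m IH sigma hm st.
have [->|nst] := eqVneq sigma tau; first exact: connect0.
have [i [j [lij adj sst]]] := weak_adjacent st nst.
have sI := @height_inj n sigma.
set rho := (sigma * tperm i j)%g in sst *.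
have lt : #|inversions sigma| < #|inversions rho|.
  apply/proper_card; rewrite properE -/(weak_le sigma rho) (weak_le_tperm lij adj).
  apply/weak_leP => /(_ i j lij); rewrite !height_tperm swap_left swap_right adj.
  by rewrite ltnSn => /(_ isT); clear; lia.
have le : #|inversions rho| <= #|inversions tau| by apply: subset_leq_card.
apply: connect_trans (IH rho _ sst); last by move: hm lt le; clear; lia.
have [cij|ncij] := boolP (cov (height sigma) dn up i j).
  apply: connect1; apply/existsP; exists i; apply/existsP; exists j.
  rewrite lij /= !insertion_cover mem_cover_arcs cij (rotate_cover sI adj lij cij).
  apply/eqP/setP=> -[x y]; rewrite !mem_cover_arcs; apply: cov_ext => a b.
  by rewrite !height_tperm.
suff -> : P rho = P sigma by apply: connect0.
apply: to_permutree_linear => x y; rewrite /= insertion_cover mem_cover_arcs => cxy.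
have lxy := cov_lt cxy; rewrite !height_tperm.
rewrite (swap_lt_pair sI adj) //; first by apply: contraNneq ncij => -[<- <-].
by apply: contraTneq lxy => -[-> ->]; rewrite adj; clear; lia.
Qed.

(** The inversions are the decreasing relations of T, which every permutation inserted above T must
    invert by [permutree_le_below]. *)
Lemma min_permutation T :
  exists2 sigma, P sigma = T & forall rho, permutree_le T (P rho) -> weak_le sigma rho.
Proof.
have [tau <-] := to_permutree_surj T; have tI := @height_inj n tau.
have [||sigma hs] := @perm_of_inversions n (fun x y => prec (height tau) dn up y x).
- by move=> x y z _ h1 h2; apply: prec_trans h2 h1.
- move=> x y z xyz h; rewrite orbC; apply: (prec_between tI h).
  by rewrite /btw xyz orbT.
exists sigma.
  apply: to_permutree_linear => x y; rewrite /= insertion_cover mem_cover_arcs.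
  case/covP=> xy _; have [lt|lt|e] := ord_ltgt x y.
  - apply: height_lt_total; first by rewrite -val_eqE neq_ltn lt.
    by rewrite hs //; apply/negP=> /prec_lt; have := prec_lt xy; clear; lia.
  - by rewrite hs.
  - by have := prec_lt xy; rewrite e ltnn.
move=> rho le; apply/weak_leP=> x y xy; rewrite hs // -below_prec.
by case: (permutree_le_below le xy) => h _ /h; rewrite below_prec => /prec_lt.
Qed.

(** Here the noninversions are the increasing relations of T, which persist in every tree below
    T. *)
Lemma max_permutation T :
  exists2 sigma, P sigma = T & forall rho, permutree_le (P rho) T -> weak_le rho sigma.
Proof.
have [tau <-] := to_permutree_surj T; have tI := @height_inj n tau.
have [||sigma hs] := @perm_of_inversions n (fun x y => ~~ prec (height tau) dn up x y).
- move=> x y z xyz /negP h1 /negP h2; apply/negP=> h.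
  by have /orP[] := prec_between tI h (b := y) (introT orP (or_introl xyz)).
- move=> x y z _; rewrite -negb_and; apply: contra => /andP[h1 h2].
  exact: prec_trans h1 h2.
exists sigma.
  apply: to_permutree_linear => x y; rewrite /= insertion_cover mem_cover_arcs.
  case/covP=> xy _; have [lt|lt|e] := ord_ltgt x y.
  - apply: height_lt_total; first by rewrite -val_eqE neq_ltn lt.
    by rewrite hs // xy.
  - by rewrite hs //; apply/negP=> /prec_lt; have := prec_lt xy; clear; lia.
  - by have := prec_lt xy; rewrite e ltnn.
move=> rho le; apply/weak_leP=> x y xy lt; rewrite hs //; apply/negP.
case: (permutree_le_below le xy) => _; rewrite !below_prec => h /h /prec_lt.
by move: lt; clear; lia.
Qed.

Lemma permutree_homomorphism :
  lattice_homomorphism (@weak_le n) (@permutree_le n delta) P.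
Proof.
apply: adjoint_lattice_homomorphism.
- exact: weak_lattice.
- by move=> T; apply: connect0.
- by move=> T1 T2 T3; apply: connect_trans.
- exact: weak_permutree_le.
- exact: min_permutation.
- exact: max_permutation.
Qed.

End PermutreeLattice.

Theorem proposition32 (n : nat) (delta : 'I_n -> decoration) :
  is_lattice (@permutree_le n delta) /\
  exists P : 'S_n -> permutree delta,
    (forall tau : 'S_n, arcs (P tau) = insertion delta tau) /\
    lattice_homomorphism (@weak_le n) (@permutree_le n delta) P.
Proof.
have hom := permutree_homomorphism delta; split; first by case: hom.
by exists (to_permutree delta).
Qed.
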